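(* Let $g=(g_1,\dots,g_q)^T:[0,1]^d\to\mathbb{R}^q$ be integrable, and let $k=k_n\in\{1,\dots,n\}$ satisfy $k\to\infty$ and $k/n\to 0$ as $n\to\infty$. (i) If $\varphi$ is a homeomorphism from $\Theta$ to $\varphi(\Theta)$ and if there exists $\varepsilon_0>0$ such that the set $\{\theta\in\Theta:\|\theta-\theta_0\|\le\varepsilon_0\}$ is closed, then for every $\varepsilon$ with $\varepsilon_0\ge\varepsilon>0$, as $n\to\infty$, $$\mathbb{P}\bigl(\hat\Theta_n\neq\varnothing \text{ and } \hat\Theta_n\subset\{\theta\in\Theta:\|\theta-\theta_0\|\le\varepsilon\}\bigr)\to 1 .$$ (ii) If, in addition to the assumptions of (i), $\theta_0$ is in the interior of $\Theta$, $\varphi$ is twice continuously differentiable and the total derivative $\dot\varphi(\theta_0)\in\mathbb{R}^{q\times p}$ is of full rank, then, with probability tending to one, $Q_{k,n}$ has a unique minimizer $\hat\theta_n$ over $\Theta$. Hence $\hat\theta_n\to\theta_0$ in probability as $n\to\infty$.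
   Context: Setting. $X_1,X_2,\dots$ are independent random vectors in $\mathbb{R}^d$, $X_i=(X_{i1},\dots,X_{id})$, with common continuous distribution function $F$ and marginal distribution functions $F_1,\dots,F_d$. It is assumed that for all $x\in[0,\infty)^d$ the limit $$l(x)=\lim_{t\downarrow0}t^{-1}\,\mathbb{P}\{1-F_1(X_{11})\le tx_1\text{ or }\dots\text{ or }1-F_d(X_{1d})\le tx_d\}$$ exists; $l$ is called the stable tail dependence function. It is assumed to belong to a parametric family of stable tail dependence functions $\{l(\cdot;\theta):\theta\in\Theta\}$, $\Theta\subset\mathbb{R}^p$, $p\ge1$, and $\theta_0\in\Theta$ is the true parameter: $l=l(\cdot;\theta_0)$. Estimator. $R_i^j$ is the rank of $X_{ij}$ among $X_{1j},\dots,X_{nj}$. The nonparametric estimator of $l$ is $$\hat l_n(x)=\frac1k\sum_{i=1}^n\mathbf{1}\Bigl\{R_i^1>n+\tfrac12-kx_1\text{ or }\dots\text{ or }R_i^d>n+\tfrac12-kx_d\Bigr\}.$$ Let $q\ge p$. Define $\varphi:\Theta\to\mathbb{R}^q$ by $\varphi(\theta)=\int_{[0,1]^d}g(x)\,l(x;\theta)\,dx$, the criterion function $$Q_{k,n}(\theta)=\Bigl\|\varphi(\theta)-\int_{[0,1]^d}g(x)\hat l_n(x)\,dx\Bigr\|^2$$ with $\|\cdot\|$ the Euclidean norm, and $\hat\Theta_n=\arg\min_{\theta\in\Theta}Q_{k,n}(\theta)$, the (possibly empty) set of minimizers of $Q_{k,n}$ over $\Theta$. $\hat\theta_n$ denotes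 a minimizer (an element of $\hat\Theta_n$). *)

(* Defs.v *)
From HB Require Import structures.
From mathcomp Require Import all_boot all_order all_algebra.
From mathcomp Require Import all_classical all_reals all_analysis.

Set Implicit Arguments.
Unset Strict Implicit.
Unset Printing Implicit Defensive.
Import Order.TTheory GRing.Theory Num.Theory.
Import numFieldNormedType.Exports.
Local Open Scope classical_set_scope.
Local Open Scope ring_scope.

(* Points of the sample space R^d are tuples (which carry the Borel sigma-algebra);
   parameters in R^p and values in R^q are row vectors (which carry the
   topology and the differential calculus). *)

(* Borel-Lebesgue measure on R^d, as the d-fold product of lebesgue_measure,
   transported from R * R^n to R^n.+1. *)
Section borel_lebesgue.
Context {R : realType}.

Definition tcons n (x : measurableTypeR R * n.-tuple R) : n.+1.-tuple R :=
  [tuple of x.1 :: x.2].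

Definition tuncons n (t : n.+1.-tuple R) : measurableTypeR R * n.-tuple R :=
  (thead t, [tuple of behead t]).

Lemma tconsK n : cancel (@tcons n) (@tuncons n).
Proof.
case=> x t; rewrite /tuncons/= theadE; congr (_, _).
by apply/val_inj.
Qed.

Lemma measurable_tcons n : measurable_fun [set: _] (@tcons n).
Proof.
by apply: measurable_cons; [exact: measurable_fst|exact: measurable_snd].
Qed.

Lemma measurable_tuncons n : measurable_fun [set: _] (@tuncons n).
Proof.
apply/measurable_fun_pairP; split; last exact: measurable_behead.
exact: (@measurable_tnth _ R n.+1 ord0).
Qed.

Section step.
Variables (n : nat) (m : {sigma_finite_measure set (n.-tuple R) -> \bar R}).

Definition lebesgue_step : set (n.+1.-tuple R) -> \bar R :=
  pushforward (@lebesgue_measure R \x m)%E (@tcons n).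

Let mpre (A : set (n.+1.-tuple R)) :
  measurable A -> measurable (@tcons n @^-1` A).
Proof. by move=> mA; rewrite -[X in measurable X]setTI; exact: measurable_tcons. Qed.

Let step0 : lebesgue_step set0 = 0%E.
Proof. by rewrite /lebesgue_step /pushforward preimage_set0 measure0. Qed.

Let step_ge0 A : (0 <= lebesgue_step A)%E.
Proof. by rewrite /lebesgue_step /pushforward measure_ge0. Qed.

Let step_sigma_additive : semi_sigma_additive lebesgue_step.
Proof.
move=> F mF tF mUF; rewrite /lebesgue_step /pushforward preimage_bigcup.
apply: measure_semi_sigma_additive.
- by move=> i; exact: mpre.
- apply/trivIsetP => /= i j _ _ ij; rewrite -preimage_setI.
  by move/trivIsetP : tF => /(_ _ _ _ _ ij) ->//; rewrite preimage_set0.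
- by rewrite -preimage_bigcup; exact: mpre.
Qed.

HB.instance Definition _ := isMeasure.Build _ _ _ lebesgue_step
  step0 step_ge0 step_sigma_additive.

Let step_sigma_finite : sigma_finite setT lebesgue_step.
Proof.
have /sigma_finiteP[F [TF ndF Foo]] := sigma_finiteT (@lebesgue_measure R).
have /sigma_finiteP[G [TG ndG Goo]] := sigma_finiteT m.
exists (fun k => @tuncons n @^-1` (F k `*` G k)).
  apply/esym; rewrite -subTset => t _.
  have [i _ Fi] : (\bigcup_i F i) (tuncons t).1 by rewrite -TF.
  have [j _ Gj] : (\bigcup_i G i) (tuncons t).2 by rewrite -TG.
  exists (maxn i j) => //; split.
  - by move: Fi; exact/subsetPset/ndF/leq_maxl.
  - by move: Gj; exact/subsetPset/ndG/leq_maxr.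
move=> k; have [mF Fk] := Foo k; have [mG Gk] := Goo k; split.
  rewrite -[X in measurable X]setTI.
  by apply: measurable_tuncons => //; exact: measurableX.
rewrite /lebesgue_step /pushforward -comp_preimage.
rewrite (_ : _ \o _ = id) ?preimage_id; last first.
  by apply/funext => x /=; rewrite tconsK.
by rewrite product_measure1E// lte_mul_pinfty// ge0_fin_numE.
Qed.

HB.instance Definition _ := Measure_isSigmaFinite.Build _ _ _ lebesgue_step
  step_sigma_finite.

End step.

Fixpoint borel_lebesgue (d : nat) :
    {sigma_finite_measure set (d.-tuple R) -> \bar R} :=
  match d with
  | 0%N => \d_[tuple]
  | n.+1 => lebesgue_step (borel_lebesgue n)
  end.

(* Completing yields Lebesgue measure on the Lebesgue sigma-algebra, so that
   integrability below is Lebesgue (not merely Borel) integrability. *)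
Definition lebesgue_tuple (d : nat) :=
  @completed_measure_extension _ _ _ (borel_lebesgue d).

Arguments lebesgue_tuple : clear implicits.

HB.instance Definition _ d := Measure.on (lebesgue_tuple d).

Definition unit_cube (d : nat) : set (d.-tuple R) :=
  [set x | forall j, 0 <= tnth x j <= 1].

End borel_lebesgue.
Arguments lebesgue_tuple {R} d.
Arguments unit_cube {R} d.

(* The norm of 'rV[R]_n in the library is the supremum norm (same topology). *)
Definition enorm {R : realType} n (v : 'rV[R]_n) : R :=
  Num.sqrt (\sum_(j < n) v ord0 j ^+ 2).

Definition homeomorphism_on {U V : topologicalType} (A : set U) (f : U -> V) :=
  {within A, continuous f} /\
  exists h : V -> U, {within f @` A, continuous h} /\
    forall x, A x -> h (f x) = x.

(* Meant for open A (here, the interior of the parameter set): f is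
   differentiable and all its directional derivatives are continuous; C2_on
   asks the same of each directional derivative. *)
Definition C1_on {R : realType} {U V : normedModType R} (A : set U) (f : U -> V) :=
  forall x, A x ->
    differentiable f x /\ forall v, {for x, continuous (fun y => 'D_v f y)}.

Definition C2_on {R : realType} {U V : normedModType R} (A : set U) (f : U -> V) :=
  C1_on A f /\ forall v, C1_on A (fun y => 'D_v f y).

Section random_vectors.
Context {R : realType} {dO : measure_display} {O : measurableType dO}.
Variable P : probability O R.
Variable d : nat.
Implicit Types X : {RV P >-> d.-tuple R}.

Definition coord X (j : 'I_d) (w : O) : R := tnth (X w) j.

Lemma measurable_coord X j : measurable_fun [set: O] (coord X j).
Proof.
exact: (measurableT_comp (@measurable_tnth _ R d j) (measurable_funPT X)).
Qed.

HB.instance Definition _ X j :=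
  isMeasurableFun.Build _ _ _ _ (coord X j) (measurable_coord X j).

Definition marginal_df X (j : 'I_d) (y : R) : R :=
  fine (cdf (coord X j : {RV P >-> R}) y).

Definition joint_df X (x : 'rV[R]_d) : R :=
  fine (P [set w | forall j, coord X j w <= x ord0 j]).

Definition mutually_independent (X : nat -> {RV P >-> d.-tuple R}) :=
  forall (s : seq nat) (A : nat -> set (d.-tuple R)),
    uniq s -> (forall i, measurable (A i)) ->
    P [set w | forall i, i \in s -> A i (X i w)] =
      (\prod_(i <- s) P (X i @^-1` A i))%E.

(* l x is the limit defining the stable tail dependence function of X;
   only the values of l on [0, oo)^d are constrained. *)
Definition has_stdf X (l : d.-tuple R -> R) :=
  forall x : d.-tuple R, (forall j, 0 <= tnth x j) ->
    t^-1 * fine (P [set w | exists j,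
      1 - marginal_df X j (coord X j w) <= t * tnth x j])
    @[t --> 0^'+] --> l x.

End random_vectors.

Definition is_stdf {R : realType} d (l : d.-tuple R -> R) :=
  exists (dO : measure_display) (O : measurableType dO) (P : probability O R)
    (X : {RV P >-> d.-tuple R}), continuous (joint_df X) /\ has_stdf X l.

Section estimation.
Context {R : realType} {dO : measure_display} {O : measurableType dO}.
Variables (P : probability O R) (d : nat) (X : nat -> {RV P >-> d.-tuple R}).

(* The sample X_1, ..., X_n is X 0, ..., X n.-1. Ties (an event of probability
   zero under continuous margins) receive the maximal rank. *)
Definition rank n (i : 'I_n) (j : 'I_d) (w : O) : nat :=
  (\sum_(m < n) (coord (X m) j w <= coord (X i) j w)%R)%N.

Definition stdf_hat n k (w : O) (x : d.-tuple R) : R :=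
  k%:R^-1 * \sum_(i < n)
    [exists j, n%:R + 2^-1 - k%:R * tnth x j < (rank i j w)%:R]%:R.

Variables (p q : nat) (g : d.-tuple R -> 'rV[R]_q).

Definition weighted_integral (f : d.-tuple R -> R) : 'rV[R]_q :=
  \row_i \int[lebesgue_tuple d]_(x in unit_cube d) (g x ord0 i * f x).

Variables (Theta : set 'rV[R]_p) (l : 'rV[R]_p -> d.-tuple R -> R).

Definition phi (theta : 'rV[R]_p) : 'rV[R]_q := weighted_integral (l theta).

Definition criterion n k (w : O) (theta : 'rV[R]_p) : R :=
  enorm (phi theta - weighted_integral (stdf_hat n k w)) ^+ 2.

Definition minimizers n k (w : O) : set 'rV[R]_p :=
  [set theta | Theta theta /\
    forall theta', Theta theta' -> criterion n k w theta <= criterion n k w theta'].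

End estimation.

Definition cvg_in_probability {R : realType} {dO : measure_display}
    {O : measurableType dO} (P : probability O R) p
    (Y : nat -> O -> 'rV[R]_p) (y : 'rV[R]_p) :=
  forall e : R, 0 < e -> P [set w | e < enorm (Y n w - y)] @[n --> \oo] --> 0%E.

(* Main.v *)
Require Import Defs.
From HB Require Import structures.
From mathcomp Require Import all_boot all_order all_algebra.
From mathcomp Require Import all_classical all_reals all_analysis.
From mathcomp Require Import measurable_realfun ring lra.

Set Implicit Arguments.
Unset Strict Implicit.
Unset Printing Implicit Defensive.
Import Order.TTheory GRing.Theory Num.Theory.
Import numFieldNormedType.Exports.
Local Open Scope classical_set_scope.
Local Open Scope ring_scope.

(* Write [U_ij = 1 - F_j (X_ij)], which is uniform since the margins are
   continuous.  A second moment bound shows that, when [n / k P(A_n)] converges,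
   the number of observations in [A_n] divided by [k] converges to the same
   limit in probability.  Applied to the margins, this traps the ranks between
   deterministic thresholds; applied to the sets
   [{exists j, U_ij < (k / n) y_j}], with [y] close to [x] on either side, it
   gives pointwise consistency of the empirical tail dependence function.
   Monotonicity and the Lipschitz property of [l] make it uniform on the cube,
   so the integrals against [g] converge in probability to [phi theta0].

   The rest is deterministic.  If [T] is close to [phi theta0], continuity of the
   inverse of [phi] makes every theta far from theta0 worse than theta0, and a
   minimizer exists by compactness.  For uniqueness, at the midpoint of two
   minimizers [a] and [b] the parallelogram law gains a quantity of order
   [|b - a|^2] (full rank of the derivative), whereas the error from the second
   derivative of [phi] is smaller because the residuals are small. *)

(** * Counting pairwise independent events *)

(** Expanding the square of the count leaves [n] diagonal terms [pi] and [n * n.-1] off-diagonal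
    terms [pi ^+ 2], so pairwise independence is enough and the variance is at most the mean. *)
Lemma count_second_moment (R : realType) (dO : measure_display)
    (O : measurableType dO) (P : probability O R) (B : nat -> set O) (pi : R)
    (n : nat) :
  (forall i, measurable (B i)) -> (forall i, P (B i) = pi%:E) ->
  (forall i j, i != j -> P (B i `&` B j) = (pi ^+ 2)%:E) ->
  (\int[P]_w ((\sum_(i < n) \1_(B i) w - n%:R * pi) ^+ 2)%:E
     <= (n%:R * pi)%:E)%E.
Proof.
move=> mB PB PBB.
set S : O -> R := fun w => \sum_(i < n) \1_(B i) w.
have pi0 : 0 <= pi by rewrite -lee_fin -(PB 0%N).
have mS : measurable_fun setT S.
  by apply: measurable_sum => i; exact: measurable_indic.
have S0 w : 0 <= S w by apply: sumr_ge0 => i _; rewrite indicE.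
have IS : (\int[P]_w (S w)%:E = (n%:R * pi)%:E)%E.
  under eq_integral do rewrite -sumEFin.
  rewrite ge0_integral_sum//; first last.
  - by move=> i; apply/measurable_EFinP; exact: measurable_indic.
  rewrite (eq_bigr (fun=> pi%:E)) ?sumEFin ?sumr_const ?card_ord ?mulr_natl// => i _.
  by rewrite integral_indic// setIT; exact: PB.
have ISS : (\int[P]_w ((S w) ^+ 2)%:E =
    (n%:R * pi + n%:R * n.-1%:R * pi ^+ 2)%:E)%E.
  have -> : (fun w => ((S w) ^+ 2)%:E) =
      (fun w => \sum_(i < n) \sum_(j < n) (\1_(B i `&` B j) w)%:E)%E.
    apply/funext => w; under eq_bigr do rewrite sumEFin.
    rewrite sumEFin expr2 /S mulr_suml; congr EFin.
    apply: eq_bigr => i _; rewrite mulr_sumr; apply: eq_bigr => j _.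
    by rewrite indicI.
  rewrite ge0_integral_sum//; first last.
  - by move=> i w _; apply: sume_ge0.
  - move=> i; apply: emeasurable_sum => j.
    by apply/measurable_EFinP/measurable_indic; exact: measurableI.
  rewrite (eq_bigr (fun=> (pi + n.-1%:R * pi ^+ 2)%:E)); last first.
    move=> i _; rewrite ge0_integral_sum//; last first.
      by move=> j; apply/measurable_EFinP/measurable_indic; exact: measurableI.
    rewrite (eq_bigr (fun j => (if j == i then pi else pi ^+ 2)%:E)); last first.
      move=> j _; rewrite integral_indic//; last exact: measurableI.
      rewrite setIT; case: eqVneq => [->|ji]; first by rewrite setIid; exact: PB.
      by apply: PBB; rewrite eq_sym.
    rewrite sumEFin (bigD1 i)//= eqxx; congr (_ + _)%:E.
    rewrite (eq_bigr (fun=> pi ^+ 2)) => [|j /negbTE -> //].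
    by rewrite sumr_const cardC1 card_ord mulr_natl.
  rewrite sumEFin sumr_const card_ord; congr EFin.
  by rewrite -[LHS]mulr_natl mulrDr mulrA.
set c := n%:R * pi.
have c0 : 0 <= c by rewrite mulr_ge0.
(* The identity is arranged with nonnegative terms on both sides, so that it can be integrated term
   by term with no integrability condition; the subtraction is made afterwards, between finite
   numbers. *)
have /esym : (\int[P]_w (((S w - c) ^+ 2)%:E + ((2 * c) * S w)%:E) =
   \int[P]_w (((S w) ^+ 2)%:E + (c ^+ 2)%:E))%E.
  apply: eq_integral => w _; rewrite -!EFinD; congr EFin; ring.
rewrite !ge0_integralD//; first last.
- by move=> w _; rewrite lee_fin sqr_ge0.
- by apply/measurable_EFinP; apply: measurable_funX.
- by move=> w _; rewrite lee_fin sqr_ge0.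
- by apply/measurable_EFinP; apply: measurable_funM.
- by move=> w _; rewrite lee_fin mulr_ge0// mulr_ge0.
- apply/measurable_EFinP; apply: measurable_funX.
  by apply: measurable_funB.
- by move=> w _; rewrite lee_fin sqr_ge0.
rewrite ISS integral_cst//= probability_setT mule1.
under [X in _ = (_ + X)%E]eq_integral do rewrite EFinM.
rewrite ge0_integralZl//; first last.
- by rewrite lee_fin mulr_ge0.
- by move=> w _; rewrite lee_fin.
- by apply/measurable_EFinP.
rewrite IS -EFinM => H.
have -> : (\int[P]_w ((S w - c) ^+ 2)%:E =
   (c + n%:R * n.-1%:R * pi ^+ 2 + c ^+ 2)%:E - (2 * c * c)%:E)%E.
  by rewrite EFinD H addeK.
rewrite -EFinB lee_fin.
suff : n%:R * n.-1%:R * pi ^+ 2 <= c ^+ 2 by move=> ?; lra.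
rewrite /c exprMn; apply: ler_wpM2r; first exact: sqr_ge0.
by rewrite expr2; apply: ler_wpM2l => //; rewrite ler_nat leq_pred.
Qed.

Lemma count_chebyshev (R : realType) (dO : measure_display)
    (O : measurableType dO) (P : probability O R) (B : nat -> set O) (pi a : R)
    (n : nat) :
  (forall i, measurable (B i)) -> (forall i, P (B i) = pi%:E) ->
  (forall i j, i != j -> P (B i `&` B j) = (pi ^+ 2)%:E) -> 0 < a ->
  (P [set w | a <= `|\sum_(i < n) \1_(B i) w - n%:R * pi| ]%R
     <= (n%:R * pi / a ^+ 2)%:E)%E.
Proof.
move=> mB PB PBB a0.
set S : O -> R := fun w => \sum_(i < n) \1_(B i) w - n%:R * pi.
have mS : measurable_fun setT S.
  by apply: measurable_funB => //; apply: measurable_sum => i; exact: measurable_indic.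
have mE : measurable [set w | a <= `|S w|].
  rewrite -[X in measurable X]setTI.
  by apply: measurable_fun_le => //; exact: measurableT_comp.
rewrite EFinM lee_pdivlMr ?exprn_gt0// muleC.
apply: le_trans (count_second_moment n mB PB PBB).
have -> : P [set w | a <= `|S w| ] = (\int[P]_w (\1_[set w | a <= `|S w| ]%R w)%:E)%E.
  by rewrite integral_indic// setIT.
rewrite -ge0_integralZl//; first last.
- by rewrite lee_fin exprn_ge0// ltW.
- by apply/measurable_EFinP/measurable_indic.
apply: ge0_le_integral => //.
- by move=> w _; rewrite -EFinM lee_fin mulr_ge0// exprn_ge0// ltW.
- by apply/measurable_EFinP/measurable_funM => //; exact: measurable_indic.
- by apply/measurable_EFinP; apply: measurable_funX.
- move=> w _; rewrite -EFinM lee_fin indicE.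
  case: (boolP (w \in _)) => [|_]; last by rewrite mulr0 sqr_ge0.
  rewrite inE /= => h; rewrite mulr1 -[leRHS]real_normK ?num_real//.
  by rewrite ler_sqr ?nnegrE// ltW.
Qed.

(** * Laws on tuples and continuous margins *)

Lemma measurable_fun_lt (R : realType) (dT : measure_display)
    (T : measurableType dT) (D : set T) (f : T -> R) :
  (forall c, measurable (D `&` [set x | f x < c])) -> measurable_fun D f.
Proof.
move=> mf mD; apply: (measurability _ (RGenInftyO.measurableE R)) => //.
move=> _ [_ [c ->] <-].
rewrite (_ : _ @^-1` _ = [set x | f x < c]); first exact: mf.
by apply/seteqP; split => x /=; rewrite in_itv.
Qed.

Definition lower_orthant (R : realType) d (a : 'rV[R]_d) : set (d.-tuple R) :=
  [set x | forall j, tnth x j <= a ord0 j].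

Lemma measurable_forall_tuple (R : realType) (d : nat) (B : 'I_d -> set R) :
  (forall j, measurable (B j)) ->
  measurable [set x : d.-tuple R | forall j, B j (tnth x j)].
Proof.
move=> mB.
rewrite (_ : mkset _ = \big[setI/setT]_(j < d) (fun x => tnth x j) @^-1` B j).
  apply: bigsetI_measurable => j _; rewrite -[X in measurable X]setTI.
  exact: measurable_tnth.
rewrite -bigcap_seq; apply/seteqP; split=> x /=.
  by move=> Bx j _; exact: Bx.
by move=> Bx j; apply: Bx => /=; rewrite mem_index_enum.
Qed.

Lemma measurable_lower_orthant (R : realType) d (a : 'rV[R]_d) :
  measurable (lower_orthant a).
Proof.
apply: (@measurable_forall_tuple _ _ (fun j => [set y | y <= a ord0 j])) => j.
by rewrite (_ : mkset _ = `]-oo, a ord0 j]%classic)// set_itvE.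
Qed.

Lemma lt_subV_near (R : realType) (y c : R) : y < c ->
  \forall m \near \oo, y <= c - m.+1%:R^-1.
Proof.
move=> yc; near=> m; rewrite lerBrDr -lerBrDl.
rewrite -[leRHS]invrK lef_pV2 ?posrE ?invr_gt0 ?subr_gt0//.
rewrite (@le_trans _ _ m%:R) ?ler_nat//.
by near: m; exact: nbhs_infty_ger.
Unshelve. all: by end_near. Qed.

(** It suffices that each coordinate is measurable for the generated sigma-algebra. An open
    half-space in direction [j] is a countable union of orthants whose corner tends to the boundary
    in coordinate [j] and to infinity in the others. *)
Lemma measurable_lower_orthantE (R : realType) (d : nat) :
  @measurable _ (d.-tuple R) = <<s range (@lower_orthant R d) >>.
Proof.
apply/seteqP; split; last first.
  apply: smallest_sub; first exact: sigma_algebra_measurable.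
  by move=> _ [a _ <-]; exact: measurable_lower_orthant.
apply: smallest_sub; first exact: smallest_sigma_algebra.
rewrite -bigcup_seq; apply: bigcup_sub => j _ _ [B mB <-].
pose T := g_sigma_algebraType (range (@lower_orthant R d)).
suff : measurable_fun setT (fun x : T => tnth x j : R) by apply.
apply: measurable_fun_lt => c; rewrite setTI.
pose a m : 'rV[R]_d := \row_i (if i == j then c - m.+1%:R^-1 else m%:R).
rewrite (_ : mkset _ = \bigcup_m lower_orthant (a m)).
  by apply: bigcup_measurable => m _; apply: sub_sigma_algebra; exists (a m).
apply/seteqP; split => x /=; last first.
  move=> [m _ /(_ j)]; rewrite mxE eqxx => /le_lt_trans; apply.
  by rewrite ltrBlDr ltrDl invr_gt0.
move=> xc; have : \forall m \near \oo, forall i, tnth x i <= a m ord0 i.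
  apply: filter_forall => i; rewrite /a; case: (eqVneq i j) => [->|ij].
    by under eq_near do rewrite mxE eqxx; exact: lt_subV_near.
  by under eq_near do rewrite mxE (negbTE ij); exact: nbhs_infty_ger.
by case=> N _ /(_ N (leqnn N)) h; exists N.
Qed.

Section law.
Context (R : realType) (dO : measure_display) (O : measurableType dO).
Variables (P : probability O R) (d : nat).
Implicit Types X Y : {RV P >-> d.-tuple R}.

Lemma lower_orthant_joint_df X a :
  P (X @^-1` lower_orthant a) = (joint_df X a)%:E.
Proof.
rewrite /joint_df fineK; first by [].
apply: fin_num_measure; rewrite -[X in measurable X]setTI.
exact: (measurable_funPT X) (measurable_lower_orthant a).
Qed.

(** Uniqueness of measures on a pi-system: orthants are stable under intersection (take minima of
    corners), generate the Borel sets and exhaust the space. This turns a common distribution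
    function into a common law, as counting in general regions requires. *)
Lemma eq_joint_df_law X Y : joint_df X = joint_df Y ->
  forall A, measurable A -> P (X @^-1` A) = P (Y @^-1` A).
Proof.
move=> XY A mA; rewrite -[LHS]/(distribution P X A) -[RHS]/(distribution P Y A).
apply: (@measure_unique _ R _ (range (@lower_orthant R d))
  (fun m => lower_orthant (const_mx m%:R)) (@measurable_lower_orthantE R d) _ _ _
  (distribution P X) (distribution P Y) _ _ A mA).
- move=> _ _ [a _ <-] [b _ <-].
  exists (\row_j Num.min (a ord0 j) (b ord0 j)) => //.
  apply/seteqP; split => x /=.
    move=> h; split => j; have := h j; rewrite mxE le_min => /andP[]//.
  by move=> [ha hb] j; rewrite mxE le_min ha hb.
- by move=> m; exists (const_mx m%:R).
- rewrite -subTset => x _.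
  have : \forall m \near \oo, forall j, tnth x j <= (m%:R : R).
    by apply: filter_forall => j; exact: nbhs_infty_ger.
  by case=> N _ /(_ N (leqnn N)) h; exists N => //= j; rewrite mxE.
- by move=> _ [a _ <-]; rewrite [LHS]lower_orthant_joint_df [RHS]lower_orthant_joint_df XY.
- move=> m; rewrite (le_lt_trans (probability_le1 _ _)) ?ltry//.
  exact: measurable_lower_orthant.
Qed.

Lemma measurable_coord_set X (j : 'I_d) (B : set R) : measurable B ->
  measurable [set w | B (Defs.coord X j w)].
Proof. by move=> mB; rewrite -[X in measurable X]setTI; exact: measurable_coord. Qed.

(** Inside an orthant whose other corners equal [m], the hyperplane has mass at most the increment
    of the joint distribution function when corner [j] moves from some [z < y] up to [y]. Continuity
    makes this vanish, and countably many [m] cover the hyperplane. *)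
Lemma continuous_joint_df_atomless X : continuous (joint_df X) ->
  forall (j : 'I_d) y, P [set w | Defs.coord X j w = y] = 0%E.
Proof.
move=> cX j y.
pose b (m : nat) (z : R) : 'rV[R]_d := \row_i (if i == j then z else m%:R).
pose E m := [set w | Defs.coord X j w = y] `&` X @^-1` lower_orthant (b m y).
have mE1 : measurable [set w | Defs.coord X j w = y].
  exact: (measurable_coord_set X j (measurable_set1 y)).
have mXo a : measurable (X @^-1` lower_orthant a).
  rewrite -[X in measurable X]setTI.
  exact: (measurable_funPT X) (measurable_lower_orthant a).
apply: measure_negligible => //.
rewrite (_ : mkset _ = \bigcup_m E m); last first.
  apply/seteqP; split => w /=; last by move=> [m _ []].
  move=> wy.
  have : \forall m \near \oo, forall i, tnth (X w) i <= b m y ord0 i.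
    apply: filter_forall => i; rewrite /b; case: (eqVneq i j) => [->|ij].
      by under eq_near do rewrite mxE eqxx; apply: nearW => _; rewrite -wy.
    by under eq_near do rewrite mxE (negbTE ij); exact: nbhs_infty_ger.
  by case=> N _ /(_ N (leqnn N)) h; exists N.
apply: negligible_bigcup => m.
apply/negligibleP; first exact: measurableI.
have PEle z : z < y -> (P (E m) <= (joint_df X (b m y) - joint_df X (b m z))%:E)%E.
  move=> zy; rewrite EFinB -!lower_orthant_joint_df.
  have zsub : X @^-1` lower_orthant (b m z) `<=` X @^-1` lower_orthant (b m y).
    move=> w /= h i; rewrite (le_trans (h i))// !mxE; case: ifP => // _.
    exact: ltW.
  rewrite -(setIidr zsub) -[leRHS](@measureD _ _ _ P)//; last first.
    by rewrite ltey_eq fin_num_measure.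
  apply: le_measure; rewrite ?inE//; first exact: measurableI.
    exact: measurableD.
  move=> w [/= wy h]; split => // /(_ j).
  by rewrite mxE eqxx -/(Defs.coord X j w) wy leNgt zy.
apply/eqP; rewrite eq_le measure_ge0 andbT; apply/lee_addgt0Pr => e e0.
rewrite add0e; have /cvgrPdist_lt /(_ _ e0) := cX (b m y).
move=> /nbhs_ballP[r /= r0 hr].
have /PEle : y - r / 2 < y by rewrite ltrBlDr ltrDl divr_gt0.
move=> /le_trans; apply; rewrite lee_fin.
apply: le_trans (ler_norm _) _; apply: ltW; apply: hr; split => // i k.
rewrite ord1 !mxE; case: eqP => _; last exact: ballxx.
rewrite /ball /= opprB addrC subrK gtr0_norm ?divr_gt0//.
by rewrite ltr_pdivrMr// ltr_pMr// ltr1n.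
Qed.
End law.

(** * Tail regions and the stable tail dependence function *)

Lemma exists_bigsetU (T : Type) (I : finType) (A : I -> set T) :
  [set w | exists i, A i w] = \big[setU/set0]_i A i.
Proof.
rewrite -bigcup_seq; apply/seteqP; split => w /=.
  by move=> [i Aiw]; exists i => //=; rewrite mem_index_enum.
by move=> [i _ Aiw]; exists i.
Qed.

Lemma measurable_exists (dT : measure_display) (T : measurableType dT)
    (I : finType) (A : I -> set T) :
  (forall i, measurable (A i)) -> measurable [set w | exists i, A i w].
Proof. by move=> mA; rewrite exists_bigsetU; exact: bigsetU_measurable. Qed.

Lemma measure_exists_le (R : realType) (dT : measure_display)
    (T : measurableType dT) (mu : {measure set T -> \bar R}) (I : finType)
    (A : I -> set T) :
  (forall i, measurable (A i)) ->
  (mu [set w | exists i, A i w] <= \sum_i mu (A i))%E.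
Proof.
move=> mA; rewrite exists_bigsetU.
suff [//] : measurable (\big[setU/set0]_i A i) /\
  (mu (\big[setU/set0]_i A i) <= \sum_i mu (A i))%E.
elim/big_ind2 : _ => [||//].
- by rewrite measure0.
- move=> A1 x1 A2 x2 [m1 l1] [m2 l2]; split; first exact: measurableU.
  by rewrite (le_trans (measureU2 _ _ _))// leeD.
Qed.

(** * Uniformity of the tail transform of an atomless variable *)

Section uniform_margin.
Context (R : realType) (dO : measure_display) (O : measurableType dO).
Variables (P : probability O R) (Y : {RV P >-> R}).
Hypothesis atomless : forall y, P [set w | Y w = y] = 0%E.

Let G y : R := fine (cdf Y y).

Let GE y : P [set w | Y w <= y] = (G y)%:E.
Proof.
rewrite /G fineK; last by apply: fin_num_measure.
by congr (P _); apply/seteqP; split => w /=; rewrite in_itv.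
Qed.

Let mYle y : measurable [set w | Y w <= y].
Proof.
rewrite -[X in measurable X]setTI.
by apply: measurable_fun_le => //; exact: measurable_funPT.
Qed.

Let mYeq y : measurable [set w | Y w = y].
Proof.
by rewrite -[X in measurable X]setTI; exact: (measurable_funPT Y measurableT _ (measurable_set1 y)).
Qed.

Lemma cdf_homo : {homo G : x y / x <= y}.
Proof.
move=> x y xy; rewrite -lee_fin -!GE; apply: le_measure; rewrite ?inE//.
by move=> w /= /le_trans; apply.
Qed.

(** Let [a] be the quantile at level [s = 1 - t], finite because [0 < t < 1]. Right continuity gives
    [s <= G a], the absence of an atom at [a] gives [G a <= s], and by monotonicity the event is the
    complement of [Y < a]. *)
Lemma cdf_tail_uniform t : 0 < t < 1 ->
  P [set w | 1 - fine (cdf Y (Y w)) <= t] = t%:E.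
Proof.
move=> /andP[t0 t1]; pose s := 1 - t.
pose A := [set y | s <= G y].
have [y1 Ay1] : A !=set0.
  have /fine_cvgP[_ /cvgr_gt] := cvg_cdfy1 Y.
  move=> /(_ s); rewrite /s ltrBlDr ltrDl => /(_ t0) [M [_ h]].
  by exists (M + 1); apply: ltW; apply: h; rewrite ltrDl.
have lbA : has_lbound A.
  have /fine_cvgP[_ /cvgr_lt] := cvg_cdfNy0 Y.
  move=> /(_ s); rewrite /s subr_gt0 => /(_ t1) [M [_ h]].
  exists M => y Ay; rewrite leNgt; apply/negP => /h /=.
  by rewrite ltNge => /negP; apply.
pose a := inf A.
have aA y : A y -> a <= y by move=> Ay; exact: ge_inf.
have below y : y < a -> G y < s.
  by move=> ya; rewrite ltNge; apply/negP => /aA; rewrite leNgt ya.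
have above y : a < y -> s <= G y.
  rewrite -subr_gt0 => ya0.
  have [z Az za] := inf_adherent ya0 (conj (ex_intro _ _ Ay1) lbA).
  apply: le_trans Az _; apply: cdf_homo; apply: ltW; move: za.
  by rewrite addrC subrK.
have sa : s <= G a.
  have : G x @[x --> a^'+] --> G a.
    apply: fine_cvg; rewrite fineK; last exact: fin_num_measure.
    exact: cdf_right_continuous.
  move=> /cvgr_to_ge; apply.
  by near=> z; apply: above; near: z; exact: nbhs_right_gt.
have mlt : measurable [set w | Y w < a].
  rewrite -[X in measurable X]setTI.
  by apply: measurable_fun_ltr => //; exact: measurable_funPT.
have PltE : P [set w | Y w < a] = (G a)%:E.
  rewrite -GE (_ : [set w | Y w <= a] = [set w | Y w < a] `|` [set w | Y w = a]).
    rewrite measureU//; last first.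
      by apply/seteqP; split => w //= [/[swap] ->]; rewrite ltxx.
    by rewrite [X in (_ + X)%E](atomless a) adde0.
  apply/seteqP; split => w /=; first by rewrite le_eqVlt => /orP[/eqP|]; [right|left].
  by move=> [/ltW//|->].
have as' : G a <= s.
  rewrite -lee_fin -PltE.
  have UE : [set w | Y w < a] = \bigcup_n [set w | Y w <= a - n.+1%:R^-1].
    apply/seteqP; split => w /=.
      by move=> /lt_subV_near[N _ /(_ N (leqnn N)) h]; exists N.
    by move=> [n _ /= /le_lt_trans]; apply; rewrite ltrBlDr ltrDl invr_gt0.
  have : P [set w | Y w <= a - n.+1%:R^-1] @[n --> \oo] --> P [set w | Y w < a].
    rewrite UE; apply: nondecreasing_cvg_mu => //; first by rewrite -UE.
    move=> n m nm; apply/subsetPset => w /= /le_trans; apply.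
    by rewrite lerD2l lerN2 lef_pV2 ?posrE// ler_nat ltnS.
  move=> /cvge_to_le; apply; apply: nearW => n.
  rewrite GE lee_fin; apply: ltW; apply: below.
  by rewrite ltrBlDr ltrDl invr_gt0.
have GaE : G a = s by apply/eqP; rewrite eq_le as' sa.
rewrite (_ : mkset _ = ~` [set w | Y w < a]); last first.
  apply/seteqP; split => w /=.
    move=> h; apply/negP; rewrite -leNgt; apply: aA.
    by rewrite /A /= /s /G lerBlDr addrC -lerBlDr.
  move=> /negP; rewrite -leNgt => /cdf_homo.
  rewrite GaE /s => h; by rewrite lerBlDr addrC -lerBlDr.
by rewrite probability_setC// PltE GaE -EFinB /s opprB addrCA subrr addr0.
Unshelve. all: by end_near. Qed.

End uniform_margin.

Section tail_regions.
Context (R : realType) (dO : measure_display) (O : measurableType dO).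
Variables (P : probability O R) (d : nat) (X : {RV P >-> d.-tuple R}).

(** Evaluated at coordinate [j] of an observation, this is the uniform variable [U_ij]. *)
Definition tail_prob (j : 'I_d) (y : R) : R := 1 - marginal_df X j y.

(** The inequality is strict, unlike in [has_stdf], so that a level [c <= 0] gives the empty region;
    [tail_region_strict] reconciles the two forms. *)
Definition margin_region (j : 'I_d) (c : R) : set (d.-tuple R) :=
  [set y | tail_prob j (tnth y j) < c].

Definition tail_region (s : 'I_d -> R) : set (d.-tuple R) :=
  [set y | exists j, margin_region j (s j) y].

Lemma tail_prob_ge0 j y : 0 <= tail_prob j y.
Proof.
rewrite subr_ge0 -lee_fin fineK; first exact: cdf_le1.
exact: fin_num_measure.
Qed.

Lemma tail_prob_homo j x y : x <= y -> tail_prob j y <= tail_prob j x.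
Proof. by move=> xy; rewrite lerD2l lerN2; exact: cdf_homo. Qed.

Lemma margin_region_le0 j c : c <= 0 -> margin_region j c = set0.
Proof.
move=> c0; apply/seteqP; split => // y /= /lt_le_trans /(_ c0).
by rewrite ltNge tail_prob_ge0.
Qed.

Lemma measurable_tail_prob j :
  measurable_fun setT (fun y : d.-tuple R => tail_prob j (tnth y j)).
Proof.
have mF : measurable_fun [set: R] (marginal_df X j).
  by apply: nondecreasing_measurable => //; exact: cdf_homo.
apply: measurable_funB => //; apply: (measurableT_comp mF).
exact: measurable_tnth.
Qed.

Lemma measurable_margin_region j c : measurable (margin_region j c).
Proof.
rewrite -[X in measurable X]setTI.
by apply: measurable_fun_ltr => //; exact: measurable_tail_prob.
Qed.

Lemma measurable_tail_region s : measurable (tail_region s).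
Proof. by apply: measurable_exists => j; exact: measurable_margin_region. Qed.

Lemma measurable_preimage (A : set (d.-tuple R)) :
  measurable A -> measurable (X @^-1` A).
Proof. by move=> mA; rewrite -[Y in measurable Y]setTI; exact: (measurable_funPT X). Qed.

Lemma measurable_margin_event j c : measurable (X @^-1` margin_region j c).
Proof. exact: measurable_preimage (measurable_margin_region j c). Qed.

Lemma measurable_tail_event s : measurable (X @^-1` tail_region s).
Proof. exact: measurable_preimage (measurable_tail_region s). Qed.

Hypothesis cX : continuous (joint_df X).

Lemma margin_le_uniform j t : 0 < t < 1 ->
  P [set w | tail_prob j (Defs.coord X j w) <= t] = t%:E.
Proof.
exact: (@cdf_tail_uniform _ _ _ P (Defs.coord X j)
  (continuous_joint_df_atomless cX j)).
Qed.

Let mle j t : measurable [set w | tail_prob j (Defs.coord X j w) <= t].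
Proof.
rewrite -[Y in measurable Y]setTI; apply: measurable_fun_le => //.
exact: (measurableT_comp (measurable_tail_prob j) (measurable_funPT X)).
Qed.

Lemma margin_region_uniform j c : 0 <= c < 1 ->
  P (X @^-1` margin_region j c) = c%:E.
Proof.
move=> /andP[]; rewrite le_eqVlt => /orP[/eqP <- _|c0 c1].
  by rewrite margin_region_le0// preimage_set0 measure0.
have mm := measurable_margin_event j c.
apply/eqP; rewrite eq_le; apply/andP; split.
  rewrite -(@margin_le_uniform j c) ?c0//.
  by apply: le_measure; rewrite ?inE// => w; exact: ltW.
apply/lee_addgt0Pr => e e0.
(* The term [c / 2] keeps the level positive, where the uniform law is available; [c - e] keeps the
   loss of probability within [e]. *)
pose c' := Num.max (c / 2) (c - e).
have c'c : c' < c by rewrite gt_max; apply/andP; split; lra.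
have c'0 : 0 < c' by rewrite lt_max; apply/orP; left; lra.
apply: (@le_trans _ _ (c'%:E + e%:E)%E).
  rewrite -EFinD lee_fin -lerBlDr /c' le_max lexx orbT//.
rewrite leeD2r// -(@margin_le_uniform j c') ?c'0 ?(lt_trans c'c)//.
by apply: le_measure; rewrite ?inE// => w /= /le_lt_trans; exact.
Qed.

Lemma margin_atomless j c : 0 <= c < 1 ->
  P [set w | tail_prob j (Defs.coord X j w) = c] = 0%E.
Proof.
move=> /andP[c0 c1].
have sub : [set w | tail_prob j (Defs.coord X j w) = c] =
    [set w | tail_prob j (Defs.coord X j w) <= c] `\` X @^-1` margin_region j c.
  apply/seteqP; split => w /=; rewrite /margin_region /=.
    by move=> ->; rewrite ltxx.
  by move=> [le /negP]; rewrite -leNgt => ge; apply/eqP; rewrite eq_le le.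
have ms : measurable [set w | tail_prob j (Defs.coord X j w) = c].
  by rewrite sub; apply: measurableD => //; exact: measurable_margin_event.
move: c0; rewrite le_eqVlt => /orP[/eqP c0|c0].
  apply/eqP; rewrite eq_le measure_ge0 andbT; apply/lee_addgt0Pr => e e0.
  (* Level zero is outside the range of [margin_le_uniform], so the event is enclosed in events of
     small positive level; the minimum with one half keeps that level below one. *)
  rewrite add0e; pose e' := Num.min e 2^-1.
  have e'0 : 0 < e' by rewrite lt_min e0 invr_gt0 ltr0n.
  have e'1 : e' < 1 by rewrite gt_min invf_lt1 ?ltr0n// ltr1n orbT.
  apply: (@le_trans _ _ e'%:E); last by rewrite lee_fin ge_min lexx.
  rewrite -(@margin_le_uniform j e') ?e'0//; apply: le_measure; rewrite ?inE//.
  by move=> w /= ->; rewrite -c0 ltW.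
have mm := measurable_margin_event j c.
rewrite sub measureD//; last by rewrite ltey_eq fin_num_measure.
rewrite (_ : _ `&` _ = X @^-1` margin_region j c); last first.
  by apply: setIidr => w; exact: ltW.
rewrite [X in (X - _)%E]margin_le_uniform ?c0// [X in (_ - X)%E]margin_region_uniform ?(ltW c0)//.
by rewrite subee.
Qed.

(** The two events differ only where some uniform variable equals its level, a finite union of null
    events. *)
Lemma tail_region_strict (s : 'I_d -> R) : (forall j, 0 <= s j < 1) ->
  P [set w | exists j, 1 - marginal_df X j (Defs.coord X j w) <= s j] =
  P (X @^-1` tail_region s).
Proof.
move=> s01.
pose E j := [set w | tail_prob j (Defs.coord X j w) = s j].
have mE j : measurable (E j).
  rewrite (_ : E j = [set w | tail_prob j (Defs.coord X j w) <= s j] `\`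
      X @^-1` margin_region j (s j)).
    by apply: measurableD => //; exact: measurable_margin_event.
  apply/seteqP; split => w /=; rewrite /E /margin_region /=.
    by move=> ->; rewrite ltxx.
  by move=> [le /negP]; rewrite -leNgt => ge; apply/eqP; rewrite eq_le le.
have mEx := measurable_exists mE.
have PEx := measure_exists_le P mE.
have PE0 : P [set w | exists i, E i w] = 0%E.
  apply/eqP; rewrite eq_le measure_ge0 andbT (le_trans PEx)//.
  by rewrite big1// => j _; exact: margin_atomless.
have mt := measurable_tail_event s.
have mL := measurable_exists (fun j => mle j (s j)).
apply/eqP; rewrite eq_le; apply/andP; split; last first.
  by apply: le_measure; rewrite ?inE// => w [j hj]; exists j; exact: ltW.
rewrite -[leRHS]adde0 -PE0.
apply: le_trans (measureU2 _ mt mEx); apply: le_measure; rewrite ?inE//.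
  exact: measurableU.
move=> w /= [j]; rewrite le_eqVlt => /orP[/eqP hj|hj]; first by right; exists j.
by left; exists j.
Qed.

Lemma tail_region_homo (s s' : 'I_d -> R) : (forall j, s j <= s' j) ->
  (P (X @^-1` tail_region s) <= P (X @^-1` tail_region s'))%E.
Proof.
move=> ss'; apply: le_measure; rewrite ?inE//;
  try exact: measurable_tail_event.
by move=> w [j /lt_le_trans hj]; exists j; exact: hj.
Qed.

(** Raising the levels adds at most the union of [d] strips, and by uniformity the strip in
    direction [j] has probability exactly [s' j - s j]. *)
Lemma tail_region_lipschitz (s s' : 'I_d -> R) :
  (forall j, 0 <= s j <= s' j) -> (forall j, s' j < 1) ->
  (P (X @^-1` tail_region s') <=
   P (X @^-1` tail_region s) + (\sum_j (s' j - s j))%:E)%E.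
Proof.
move=> ss' s'1.
pose E j := X @^-1` (margin_region j (s' j) `\` margin_region j (s j)).
have mE j : measurable (E j).
  by apply: measurable_preimage; apply: measurableD; exact: measurable_margin_region.
have PE j : P (E j) = (s' j - s j)%:E.
  have /andP[s0 sle] := ss' j.
  rewrite -[E j]/(X @^-1` margin_region j (s' j) `\` X @^-1` margin_region j (s j)).
  rewrite measureD; first last.
  - by rewrite ltey_eq fin_num_measure//; exact: measurable_margin_event.
  - exact: measurable_margin_event.
  - exact: measurable_margin_event.
  rewrite (_ : _ `&` _ = X @^-1` margin_region j (s j)); last first.
    by apply: setIidr => w /lt_le_trans; exact.
  rewrite [X in (X - _)%E]margin_region_uniform ?(le_trans s0) ?s'1//.
  by rewrite [X in (_ - X)%E]margin_region_uniform ?s0 ?(le_lt_trans sle).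
have mEx := measurable_exists mE.
have PEx := measure_exists_le P mE.
have mt r := measurable_tail_event r.
apply: (@le_trans _ _ (P (X @^-1` tail_region s) + P [set w | exists i, E i w])%E).
  apply: le_trans (measureU2 _ (mt s) mEx); apply: le_measure; rewrite ?inE//.
    exact: measurableU.
  move=> w /= [j hj].
  have [hs|hs] := pselect (margin_region j (s j) (X w)); [left|right]; by exists j.
by rewrite leeD2l// (le_trans PEx)// (eq_bigr _ (fun j _ => PE j)) sumEFin.
Qed.

End tail_regions.

(** * Monotonicity and Lipschitz property of the stable tail dependence function *)

Section stdf_properties.
Context (R : realType) (dO : measure_display) (O : measurableType dO).
Variables (P : probability O R) (d : nat) (X : {RV P >-> d.-tuple R}).
Variable (l : d.-tuple R -> R).
Hypothesis (cX : continuous (joint_df X)) (lX : has_stdf X l).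

Lemma near_scaled_lt1 (y : d.-tuple R) : (forall j, 0 <= tnth y j) ->
  \forall t \near (0:R)^'+, 0 < t /\ forall j, 0 <= t * tnth y j < 1.
Proof.
move=> y0; have S0 : 0 < 1 + \sum_j tnth y j by rewrite ltr_pwDl// sumr_ge0.
near=> t.
have t0 : 0 < t by near: t; exact: nbhs_right_gt.
split => // j; rewrite mulr_ge0 ?(ltW t0)//=.
apply: (@le_lt_trans _ _ (t * \sum_j tnth y j)).
  by rewrite ler_wpM2l ?(ltW t0)// (bigD1 j)//= lerDl sumr_ge0.
apply: (@lt_le_trans _ _ (t * (1 + \sum_j tnth y j))).
  by rewrite ltr_pM2l// ltrDr.
rewrite -ler_pdivlMr// div1r; near: t; apply: nbhs_right_le.
by rewrite invr_gt0.
Unshelve. all: by end_near. Qed.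

Lemma stdf_strict (y : d.-tuple R) : (forall j, 0 <= tnth y j) ->
  t^-1 * fine (P (X @^-1` tail_region X (fun j => t * tnth y j)))
    @[t --> 0^'+] --> l y.
Proof.
move=> y0; apply: cvg_trans (lX y0); apply: near_eq_cvg; near=> t.
rewrite tail_region_strict//.
by near: t; apply: filterS (near_scaled_lt1 y0) => t [].
Unshelve. all: by end_near. Qed.

Lemma stdf_homo (x y : d.-tuple R) :
  (forall j, 0 <= tnth x j <= tnth y j) -> l x <= l y.
Proof.
move=> xy.
have x0 j : 0 <= tnth x j by have /andP[] := xy j.
have y0 j : 0 <= tnth y j by have /andP[/le_trans h /h] := xy j.
apply: (ler_cvg_to (stdf_strict x0) (stdf_strict y0)); near=> t.
have t0 : 0 < t by near: t; exact: nbhs_right_gt.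
rewrite ler_wpM2l ?invr_ge0 ?(ltW t0)// fine_le//.
- by apply: fin_num_measure; exact: measurable_tail_event.
- by apply: fin_num_measure; exact: measurable_tail_event.
apply: tail_region_homo => j; rewrite ler_wpM2l ?(ltW t0)//.
by have /andP[] := xy j.
Unshelve. all: by end_near. Qed.

(** The bound of [tail_region_lipschitz] is linear in the levels, so at levels [t * tnth x j] and
    [t * tnth y j], after division by [t], it no longer depends on [t] and survives the limit. *)
Lemma stdf_lipschitz (x y : d.-tuple R) :
  (forall j, 0 <= tnth x j <= tnth y j) ->
  l y <= l x + \sum_j (tnth y j - tnth x j).
Proof.
move=> xy.
have x0 j : 0 <= tnth x j by have /andP[] := xy j.
have y0 j : 0 <= tnth y j by have /andP[/le_trans h /h] := xy j.
have Hx : t^-1 * fine (P (X @^-1` tail_region X (fun j => t * tnth x j))) +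
    \sum_j (tnth y j - tnth x j) @[t --> 0^'+] --> l x + \sum_j (tnth y j - tnth x j).
  by apply: cvgD; [exact: stdf_strict|exact: cvg_cst].
apply: (ler_cvg_to (stdf_strict y0) Hx); near=> t.
have [t0 ty] : 0 < t /\ forall j, 0 <= t * tnth y j < 1.
  by near: t; exact: near_scaled_lt1.
have mt s : P (X @^-1` tail_region X s) \is a fin_num.
  by apply: fin_num_measure; exact: measurable_tail_event.
rewrite ler_pdivrMl// mulrDr mulrA divff ?gt_eqF// mul1r -lee_fin EFinD !fineK//.
rewrite mulr_sumr; under eq_bigr do rewrite mulrBr.
apply: tail_region_lipschitz => // j; last by have /andP[] := ty j.
by have /andP[? ?] := xy j; rewrite mulr_ge0 ?(ltW t0)//= ler_wpM2l ?(ltW t0).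
Unshelve. all: by end_near. Qed.

End stdf_properties.

(** * Law of large numbers and consistency of the empirical function *)

Lemma measurable_forall (dT : measure_display) (T : measurableType dT)
    (I : finType) (A : I -> set T) :
  (forall i, measurable (A i)) -> measurable [set w | forall i, A i w].
Proof.
move=> mA; rewrite -[X in measurable X]setCK; apply: measurableC.
rewrite (_ : ~` _ = [set w | exists i, (~` A i) w]).
  by apply: measurable_exists => i; exact: measurableC.
by apply/seteqP; split => w /=; rewrite -existsNP.
Qed.

(** * Events whose probability tends to one *)

Section high_probability.
Context (R : realType) (dO : measure_display) (O : measurableType dO).
Variable P : probability O R.
Implicit Types E : nat -> set O.

(** Bounding the complements, rather than stating a limit, makes inclusions and finite intersections
    follow from monotonicity and the union bound. *)
Definition whp E := (forall n, measurable (E n)) /\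
  forall e : R, 0 < e -> \forall n \near \oo, (P (~` E n) <= e%:E)%E.

Lemma whp_sub E E' : whp E -> (forall n, measurable (E' n)) ->
  (\forall n \near \oo, E n `<=` E' n) -> whp E'.
Proof.
move=> [mE hE] mE' EE'; split => // e /hE; apply: filterS2 EE' => n EE'.
apply: le_trans; apply: le_measure; rewrite ?inE; try exact: measurableC.
exact: subsetC.
Qed.

Lemma whp_forall (I : finType) (E : I -> nat -> set O) :
  (forall i, whp (E i)) -> whp (fun n => [set w | forall i, E i n w]).
Proof.
move=> hE; split=> [n|e e0].
  by apply: measurable_forall => i; exact: (hE i).1.
(* Each complement gets an equal share of [e]; the successor keeps the denominator nonzero when [I]
   is empty. *)
have e'0 : 0 < e / #|I|.+1%:R by rewrite divr_gt0.
have : \forall n \near \oo, forall i, (P (~` E i n) <= (e / #|I|.+1%:R)%:E)%E.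
  by apply: (@filter_forall _ _ _ \oo) => i; exact: (hE i).2.
apply: filterS => n hn.
rewrite (_ : ~` _ = [set w | exists i, (~` E i n) w]); last first.
  by apply/seteqP; split => w /=; rewrite -existsNP.
apply: (le_trans (measure_exists_le P _)).
  by move=> i; apply: measurableC; exact: (hE i).1.
apply: (@le_trans _ _ (\sum_(i : I) (e / #|I|.+1%:R)%:E)%E).
  by apply: lee_sum => i _; exact: hn.
rewrite sumEFin sumr_const lee_fin -[leLHS]mulr_natr -mulrA ler_piMr ?(ltW e0)//.
by rewrite [leLHS]mulrC ler_pdivrMr// mul1r ler_nat.
Qed.

Lemma whpI E E' : whp E -> whp E' -> whp (fun n => E n `&` E' n).
Proof.
move=> hE hE'.
have h (b : bool) : whp (if b then E else E') by case: b.
have mI n : measurable (E n `&` E' n) by apply: measurableI; [exact: hE.1|exact: hE'.1].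
apply: whp_sub (whp_forall h) mI _; apply: nearW => n w /= H.
by split; [exact: (H true)|exact: (H false)].
Qed.

Lemma whp_cvg0 E A : whp E -> (forall n, measurable (A n)) ->
  (\forall n \near \oo, A n `<=` ~` E n) -> P (A n) @[n --> \oo] --> 0%E.
Proof.
move=> [mE hE] mA AE; apply: cvg_EFin.
  by apply: nearW => n; exact: fin_num_measure.
apply/cvgrPdist_le => e /hE; apply: filterS2 AE => n AE PE.
rewrite sub0r normrN /= ger0_norm; last by rewrite fine_ge0.
rewrite -lee_fin fineK ?fin_num_measure//; apply: le_trans PE.
by apply: le_measure; rewrite ?inE//; exact: measurableC.
Qed.

Lemma whp_cvg1 E : whp E -> P (E n) @[n --> \oo] --> 1%E.
Proof.
move=> hE; have mE := hE.1.
have -> : (fun n => P (E n)) = (fun n => (1 - P (~` E n))%E).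
  apply/funext => n; rewrite probability_setC// oppeB ?fin_num_adde_defr//.
  by rewrite addeA subee// add0e.
rewrite -[X in _ --> X]sube0; apply: cvgeB => //; first exact: cvg_cst.
by apply: (whp_cvg0 hE) => [n|]; [exact: measurableC|by apply: nearW => n w].
Qed.

End high_probability.

Section law_of_large_numbers.
Context (R : realType) (dO : measure_display) (O : measurableType dO).
Variables (P : probability O R) (d : nat) (X : nat -> {RV P >-> d.-tuple R}).
Hypothesis hindep : mutually_independent X.
Hypothesis same_law : forall i A, measurable A ->
  P (X i @^-1` A) = P (X 0%N @^-1` A).

(** A tail empirical measure: the factor is the inverse of [k], not of [n], since the sets of
    interest have probability of order [k / n]. *)
Definition scaled_count n k (A : set (d.-tuple R)) (w : O) : R :=
  k%:R^-1 * \sum_(i < n) \1_A (X i w).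

Lemma measurable_scaled_count n k A : measurable A ->
  measurable_fun setT (scaled_count n k A).
Proof.
move=> mA; apply: measurable_funM => //; apply: measurable_sum => i.
apply: (@measurableT_comp _ _ _ _ _ _ (\1_A : _ -> R)).
  exact: measurable_indic.
exact: measurable_funPT.
Qed.

(** The set changes with [n]. The scaled count has mean [r = n / k * P(A_n)], bounded because it
    converges, and variance at most [r / k], which vanishes as [k] grows; Chebyshev's inequality
    concludes. *)
Lemma scaled_count_lln (k : nat -> nat) (A : nat -> set (d.-tuple R)) (c e : R) :
  (forall n, measurable (A n)) -> k n @[n --> \oo] --> \oo ->
  n%:R / (k n)%:R * fine (P (X 0%N @^-1` A n)) @[n --> \oo] --> c -> 0 < e ->
  whp P (fun n => [set w | `|scaled_count n (k n) (A n) w - c| < e]).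
Proof.
move=> mA koo hc e0; split=> [n|eta eta0].
  rewrite -[Y in measurable Y]setTI; apply: measurable_fun_ltr => //.
  apply: measurableT_comp => //; apply: measurable_funB => //.
  exact: measurable_scaled_count.
(* Half of [e] covers the distance from the mean to [c]. For the other half, Chebyshev gives
   [4 * r / (e ^+ 2 * k)] with [r <= |c| + 1], which is at most [eta] as soon as [k] reaches [M]. *)
pose M := 4 * (`|c| + 1) / (e ^+ 2 * eta).
near=> n.
have kM : M + 1 <= (k n)%:R.
  near: n; apply: (@koo [set m | M + 1 <= m%:R]); exact: nbhs_infty_ger.
have rc : `|c - n%:R / (k n)%:R * fine (P (X 0%N @^-1` A n))| < Num.min (e / 2) 1.
  near: n; move/cvgrPdist_lt : hc => /(_ (Num.min (e / 2) 1)); apply.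
  by rewrite lt_min ltr01 andbT divr_gt0.
have M0 : 0 <= M.
  by rewrite divr_ge0// ?mulr_ge0 ?addr_ge0// ?exprn_ge0// ltW.
have k0 : 0 < (k n)%:R :> R by apply: lt_le_trans kM; rewrite ltr_wpDl.
pose pi := fine (P (X 0%N @^-1` A n)).
have mXA i : measurable (X i @^-1` A n) by exact: measurable_preimage.
have piE i : P (X i @^-1` A n) = pi%:E by rewrite same_law// fineK// fin_num_measure.
pose r := n%:R / (k n)%:R * pi.
move: rc; rewrite -/pi -/r lt_min => /andP[rc1 rc2].
have rle : r <= `|c| + 1.
  have := ler_norm (r - c); rewrite distrC => h.
  have := ler_norm c; lra.
have ke0 : 0 < (k n)%:R * (e / 2) by rewrite mulr_gt0// divr_gt0.
have PBB i j : i != j -> P (X i @^-1` A n `&` X j @^-1` A n) = (pi ^+ 2)%:E.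
  move=> ij; have := @hindep [:: i; j] (fun=> A n).
  rewrite /= inE ij => /(_ isT (fun=> mA n)).
  rewrite !big_cons big_nil mule1 !piE -EFinM -expr2 => <-.
  congr (P _); apply/seteqP; split => w /=.
    by move=> [hi hj] m; rewrite !inE => /orP[] /eqP ->.
  by move=> h; split; apply: h; rewrite !inE eqxx ?orbT.
have := count_chebyshev n mXA piE PBB ke0.
set Ev := (X in (P X <= _)%E -> _) => cheb.
have mEv : measurable Ev.
  rewrite -[Y in measurable Y]setTI; apply: measurable_fun_le => //.
  apply: measurableT_comp => //; apply: measurable_funB => //.
  apply: measurable_sum => i; exact: measurable_indic.
apply: (@le_trans _ _ (P Ev)).
  apply: le_measure; rewrite ?inE//.
    apply: measurableC; rewrite -[Y in measurable Y]setTI.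
    apply: measurable_fun_ltr => //.
    apply: measurableT_comp => //; apply: measurable_funB => //.
    exact: measurable_scaled_count.
  move=> w /= /negP; rewrite -leNgt => hw.
  have : e / 2 <= `|scaled_count n (k n) (A n) w - r|.
    have := ler_normD (scaled_count n (k n) (A n) w - r) (r - c).
    rewrite addrA subrK [`|r - c|]distrC; lra.
  rewrite -(ler_pM2l k0) -{2}[(k n)%:R]ger0_norm ?(ltW k0)// -normrM mulrBr.
  rewrite /scaled_count mulVKf ?gt_eqF//.
  have -> // : (k n)%:R * r = n%:R * pi by rewrite /r; field; rewrite gt_eqF.
apply: (le_trans cheb); rewrite lee_fin.
have -> : n%:R * pi / ((k n)%:R * (e / 2)) ^+ 2 = r * 4 / (e ^+ 2 * (k n)%:R).
  by rewrite /r; field; rewrite !gt_eqF.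
rewrite ler_pdivrMr; last by rewrite mulr_gt0// exprn_gt0.
apply: (@le_trans _ _ ((`|c| + 1) * 4)); first by rewrite ler_wpM2r.
have : M <= (k n)%:R by apply: le_trans kM; rewrite lerDl.
rewrite /M ler_pdivrMr; last by rewrite mulr_gt0// exprn_gt0.
move=> h; rewrite mulrC (le_trans h)// le_eqVlt; apply/orP; left; apply/eqP; ring.
Unshelve. all: by end_near. Qed.

End law_of_large_numbers.

Section empirical_stdf.
Context (R : realType) (dO : measure_display) (O : measurableType dO).
Variables (P : probability O R) (d : nat) (X : nat -> {RV P >-> d.-tuple R}).

(* The estimator is a function of the finitely many order comparisons between
   the observations, so every event about it is measurable. *)
Lemma measurable_stdf_hat_event n k (S : set (d.-tuple R -> R)) :
  measurable [set w | S (stdf_hat X n k w)].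
Proof.
pose c (w : O) : {ffun 'I_n * 'I_n * 'I_d -> bool} :=
  [ffun u : 'I_n * 'I_n * 'I_d => Defs.coord (X u.1.1) u.2 w <= Defs.coord (X u.1.2) u.2 w].
pose hat (b : {ffun 'I_n * 'I_n * 'I_d -> bool}) (x : d.-tuple R) : R :=
  k%:R^-1 * \sum_(i < n) [exists j, n%:R + 2^-1 - k%:R * tnth x j <
    (\sum_(m < n) b (m, i, j))%N%:R]%:R.
have hatE w : stdf_hat X n k w = hat (c w).
  apply/funext => x; rewrite /stdf_hat /hat; congr (_ * _).
  apply: eq_bigr => i _; congr ((nat_of_bool _)%:R).
  apply: eq_existsb => j; congr (_ < _%:R).
  by rewrite /Defs.rank; apply: eq_bigr => m _; rewrite ffunE.
rewrite (_ : mkset _ = [set w | exists b, S (hat b) /\ c w = b]); last first.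
  apply/seteqP; split => w /=; rewrite hatE.
    by move=> h; exists (c w).
  by move=> [b [h ->]].
apply: (@measurable_exists _ _ _ (fun b => [set w | S (hat b) /\ c w = b])) => b.
have [Sb|nSb] := pselect (S (hat b)); last first.
  by rewrite (_ : mkset _ = set0)//; apply/seteqP; split => // w [].
rewrite (_ : mkset _ = [set w | forall u : 'I_n * 'I_n * 'I_d,
    (Defs.coord (X u.1.1) u.2 w <= Defs.coord (X u.1.2) u.2 w) = b u]); last first.
  apply/seteqP; split => w /=; first by move=> [_ <-] u; rewrite ffunE.
  by move=> h; split => //; apply/ffunP => u; rewrite ffunE.
apply: (@measurable_forall _ _ _ (fun u : 'I_n * 'I_n * 'I_d =>
  [set w | (Defs.coord (X u.1.1) u.2 w <= Defs.coord (X u.1.2) u.2 w) = b u])) => u.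
have mle : measurable [set w | Defs.coord (X u.1.1) u.2 w <= Defs.coord (X u.1.2) u.2 w].
  rewrite -[Y in measurable Y]setTI.
  by apply: measurable_fun_le => //; exact: measurable_coord.
case: (b u) => //; rewrite (_ : mkset _ =
    ~` [set w | Defs.coord (X u.1.1) u.2 w <= Defs.coord (X u.1.2) u.2 w]).
  exact: measurableC.
by apply/seteqP; split => w /=; [move=> ->|move=> /negP/negbTE].
Qed.

Lemma stdf_hat_homo n k w (x y : d.-tuple R) :
  (forall j, tnth x j <= tnth y j) -> stdf_hat X n k w x <= stdf_hat X n k w y.
Proof.
move=> xy; rewrite ler_wpM2l ?invr_ge0//; apply: ler_sum => i _.
rewrite ler_nat; case: existsP => // -[j hj].
rewrite (_ : [exists _, _] = true)//; apply/existsP; exists j.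
by apply: le_lt_trans hj; rewrite lerD2l lerN2 ler_wpM2l.
Qed.

End empirical_stdf.

(** * From ranks to deterministic thresholds, and consistency of the estimator *)

Section consistency.
Context (R : realType) (dO : measure_display) (O : measurableType dO).
Variables (P : probability O R) (d : nat) (X : nat -> {RV P >-> d.-tuple R}).

(** The observations counted by the rank lie at or below [X_ij], while those in the region lie
    strictly above it, because [tail_prob] is nonincreasing. The two index sets are disjoint, so
    their sizes add up to at most [n]. *)
Lemma rank_margin_le n (i : 'I_n) j c w :
  c <= tail_prob (X 0%N) j (Defs.coord (X i) j w) ->
  (Defs.rank X i j w)%:R +
    \sum_(m < n) \1_(margin_region (X 0%N) j c) (X m w) <= n%:R :> R.
Proof.
move=> ic; rewrite /Defs.rank natr_sum -big_split/=.
rewrite -[leRHS](_ : \sum_(m < n) 1 = n%:R); last by rewrite sumr_const card_ord.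
apply: ler_sum => m _; rewrite indicE.
case: (boolP (_ \in _)); last by rewrite addr0 lern1 leq_b1.
rewrite inE /margin_region /= => mc.
rewrite (_ : (Defs.coord (X m) j w <= _) = false) ?add0r//; apply: contraTF ic => mi.
by rewrite -ltNge; apply: le_lt_trans mc; exact: tail_prob_homo.
Qed.

(** Dually, an observation not counted by the rank lies strictly above [X_ij], hence in the region:
    the two index sets cover the sample. *)
Lemma rank_margin_ge n (i : 'I_n) j c w :
  tail_prob (X 0%N) j (Defs.coord (X i) j w) < c ->
  n%:R <= (Defs.rank X i j w)%:R +
    \sum_(m < n) \1_(margin_region (X 0%N) j c) (X m w) :> R.
Proof.
move=> ic; rewrite /Defs.rank natr_sum -big_split/=.
rewrite -[leLHS](_ : \sum_(m < n) 1 = n%:R); last by rewrite sumr_const card_ord.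
apply: ler_sum => m _; rewrite indicE.
have [mi|im] := leP (Defs.coord (X m) j w) (Defs.coord (X i) j w).
  by rewrite lerDl.
rewrite mem_set ?add0r// /margin_region /=.
by apply: le_lt_trans ic; apply: tail_prob_homo; exact: ltW.
Qed.

(** If [X_i] is outside the region in coordinate [j], its rank is at most [n] minus the count, hence
    at most [n - k x_j], and it cannot pass the threshold of the estimator. Here the [1/2] in the
    threshold only helps. *)
Lemma stdf_hat_le_count n k w (x : d.-tuple R) (s : 'I_d -> R) :
  (forall j, k%:R * tnth x j <=
     \sum_(m < n) \1_(margin_region (X 0%N) j (s j)) (X m w)) ->
  stdf_hat X n k w x <= scaled_count X n k (tail_region (X 0%N) s) w.
Proof.
move=> hs; rewrite ler_wpM2l ?invr_ge0//; apply: ler_sum => i _.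
rewrite indicE ler_nat; case: existsP => // -[j hj].
rewrite mem_set//; exists j; rewrite /margin_region /= ltNge; apply/negP => ge.
have := rank_margin_le ge; have := hs j; move: hj.
set N := \sum_(m < n) _; lra.
Qed.

(** In this direction the [1/2] in the threshold must be paid for: a point in the region has rank at
    least [n] minus the count, which has to exceed [n + 1/2 - k x_j]. A nonpositive level gives an
    empty region and imposes nothing. *)
Lemma count_le_stdf_hat n k w (x : d.-tuple R) (s : 'I_d -> R) :
  (forall j, s j <= 0 \/ 2^-1 +
     \sum_(m < n) \1_(margin_region (X 0%N) j (s j)) (X m w) < k%:R * tnth x j) ->
  scaled_count X n k (tail_region (X 0%N) s) w <= stdf_hat X n k w x.
Proof.
move=> hs; rewrite ler_wpM2l ?invr_ge0//; apply: ler_sum => i _.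
rewrite indicE ler_nat; case: (boolP (_ \in _)) => //; rewrite inE => -[j hj].
have [|Nj] := hs j; first by move=> /margin_region_le0 s0; rewrite s0 in hj.
rewrite (_ : [exists _, _] = true)//; apply/existsP; exists j.
have := rank_margin_ge hj; move: Nj; set N := \sum_(m < n) _; lra.
Qed.

Variables (l : d.-tuple R -> R) (k : nat -> nat).
Hypothesis hindep : mutually_independent X.
Hypothesis same_law : forall i A, measurable A ->
  P (X i @^-1` A) = P (X 0%N @^-1` A).
Hypothesis cX : continuous (joint_df (X 0%N)).
Hypothesis hl : has_stdf (X 0%N) l.
Hypothesis hk : forall n, (1 <= n)%N -> (1 <= k n <= n)%N.
Hypothesis koo : k n @[n --> \oo] --> \oo.
Hypothesis hkn : (k n)%:R / n%:R @[n --> \oo] --> (0 : R).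

Let ratio n : R := (k n)%:R / n%:R.

Lemma near_ratio_gt0 : \forall n \near \oo, 0 < ratio n.
Proof.
near=> n; have n0 : (1 <= n)%N by near: n; exact: nbhs_infty_ge.
have /andP[k1 _] := hk n0.
by rewrite divr_gt0 ?ltr0n.
Unshelve. all: by end_near. Qed.

Lemma ratio_at_right : ratio n @[n --> \oo] --> (0:R)^'+.
Proof.
move=> A [/= r r0 hA]; rewrite -[_ A]/(\forall n \near \oo, A (ratio n)); near=> n.
have rn0 : 0 < ratio n by near: n; exact: near_ratio_gt0.
apply: hA => //=; near: n; move/cvgrPdist_lt : hkn; exact.
Unshelve. all: by end_near. Qed.

(** The limit that defines [l] is taken along [t = k / n], for which [t^-1] is the normalisation
    [n / k] of the counts. *)
Lemma tail_count_whp (y : d.-tuple R) (e : R) : (forall j, 0 <= tnth y j) ->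
  0 < e ->
  whp P (fun n => [set w | `|scaled_count X n (k n)
     (tail_region (X 0%N) (fun j => ratio n * tnth y j)) w - l y| < e]).
Proof.
move=> y0 e0; apply: scaled_count_lln => //.
  by move=> n; exact: measurable_tail_region.
have := cvg_comp _ _ ratio_at_right (stdf_strict cX hl y0).
apply: cvg_trans; apply: near_eq_cvg; near=> n.
by rewrite /= /ratio invf_div.
Unshelve. all: by end_near. Qed.

(** By uniformity the normalised mean equals [y] exactly once [k / n * y < 1]. *)
Lemma margin_count_whp j (y e : R) : 0 <= y -> 0 < e ->
  whp P (fun n => [set w | `|scaled_count X n (k n)
     (margin_region (X 0%N) j (ratio n * y)) w - y| < e]).
Proof.
move=> y0 e0; apply: scaled_count_lln => //.
  by move=> n; exact: measurable_margin_region.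
apply: cvg_near_cst; near=> n.
have rn0 : 0 < ratio n by near: n; exact: near_ratio_gt0.
have ry : ratio n * y < 1.
  apply: (@le_lt_trans _ _ (ratio n * (y + 1))).
    by rewrite ler_wpM2l ?(ltW rn0)// lerDl.
  rewrite -ltr_pdivlMr ?ltr_wpDl// div1r.
  have : `|0 - ratio n| < (y + 1)^-1.
    by near: n; move/cvgrPdist_lt : hkn; apply; rewrite invr_gt0 ltr_wpDl.
  by rewrite sub0r normrN gtr0_norm.
rewrite /= margin_region_uniform//=; last by rewrite mulr_ge0// ltW.
rewrite mulrA -[n%:R / _]invf_div -/(ratio n) mulVf ?mul1r// gt_eqF//.
Unshelve. all: by end_near. Qed.

(* The rank of [X_ij] exceeds [n + 1/2 - k x_j] iff fewer than [k x_j - 1/2]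
   sample points lie beyond it in coordinate [j]; the empirical margins decide
   this up to a shift of [x_j] by [dl]. *)
Lemma stdf_hat_pointwise (x : d.-tuple R) (e : R) : (forall j, 0 <= tnth x j) ->
  0 < e ->
  whp P (fun n => [set w | `|stdf_hat X n (k n) w x - l x| <= e]).
Proof.
move=> x0 e0.
(* Shifting all [d] coordinates by [dl] changes [l] by at most [d * dl <= e / 2]; the other half of
   [e] is left for the fluctuation of the counts. *)
pose dl := e / (2 * d.+1%:R).
have dl0 : 0 < dl by rewrite divr_gt0// mulr_gt0.
have ddl : d%:R * dl <= e / 2.
  rewrite /dl invfM [e * _]mulrA mulrCA ler_piMr ?divr_ge0 ?(ltW e0)//.
  by rewrite ler_pdivrMr// mul1r ler_nat.
pose xp := [tuple tnth x j + dl | j < d].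
(* Truncation at zero keeps the lower point in the domain where [l] is determined. *)
pose xm := [tuple Num.max (tnth x j - dl) 0 | j < d].
have xp0 j : 0 <= tnth xp j by rewrite tnth_mktuple addr_ge0// ltW.
have xm0 j : 0 <= tnth xm j by rewrite tnth_mktuple le_max lexx orbT.
have e20 : 0 < e / 2 by rewrite divr_gt0.
have dl20 : 0 < dl / 2 by rewrite divr_gt0.
have lxp : l xp <= l x + e / 2.
  apply: le_trans (@stdf_lipschitz _ _ _ _ _ _ _ cX hl x xp _) _.
    by move=> j; rewrite x0 tnth_mktuple lerDl ltW.
  rewrite lerD2l; apply: le_trans ddl.
  under eq_bigr do rewrite tnth_mktuple addrAC subrr add0r.
  by rewrite sumr_const card_ord mulr_natl.
have lxm : l x - e / 2 <= l xm.
  rewrite lerBlDr; apply: le_trans (@stdf_lipschitz _ _ _ _ _ _ _ cX hl xm x _) _.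
    by move=> j; rewrite xm0 tnth_mktuple ge_max x0 andbT gerBl ltW.
  rewrite lerD2l; apply: le_trans ddl.
  apply: (@le_trans _ _ (\sum_(j < d) dl)); last first.
    by rewrite sumr_const card_ord mulr_natl.
  by apply: ler_sum => j _; rewrite tnth_mktuple lerBlDr -lerBlDl le_max lexx.
have W1 := whp_forall (fun j => margin_count_whp j (xp0 j) dl20).
have W2 := whp_forall (fun j => margin_count_whp j (xm0 j) dl20).
have W3 := tail_count_whp xp0 e20.
have W4 := tail_count_whp xm0 e20.
apply: whp_sub (whpI (whpI W1 W2) (whpI W3 W4)) _ _.
  by move=> n; exact: (measurable_stdf_hat_event X n (k n) (fun f => `|f x - l x| <= e)).
near=> n.
have n0 : (1 <= n)%N by near: n; exact: nbhs_infty_ge.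
have /andP[k1 _] := hk n0.
have k0 : 0 < (k n)%:R :> R by rewrite ltr0n.
(* In units of [x], the [1/2] of the rank threshold amounts to [1 / (2k)]. It must stay below
   [dl / 2], the other half of the shift being used by the deviation of the marginal counts. *)
have kdl : 1 < (k n)%:R * dl.
  rewrite -ltr_pdivrMr// div1r; near: n.
  apply: (@koo [set m | dl^-1 < m%:R]); exact: nbhs_infty_gtr.
move=> w [[/= H1 H2] [/= H3 H4]].
have countE A : scaled_count X n (k n) A w * (k n)%:R = \sum_(m < n) \1_A (X m w).
  by rewrite mulrC mulVKf// gt_eqF.
rewrite ler_distl; apply/andP; split.
  apply: (@le_trans _ _ (scaled_count X n (k n)
     (tail_region (X 0%N) (fun j => ratio n * tnth xm j)) w)).
    by move: H4; rewrite ltr_distl => /andP[+ _]; move: lxm; lra.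
  apply: count_le_stdf_hat => j.
  (* A truncated coordinate has level zero, which is the first alternative of
     [count_le_stdf_hat]. *)
  have [xj|xj] := leP (tnth x j) dl.
    left; rewrite tnth_mktuple (_ : Num.max _ _ = 0) ?mulr0//.
    by apply/max_idPr; rewrite subr_le0.
  right; rewrite -countE.
  have := H2 j; rewrite ltr_distl => /andP[_].
  have -> : tnth xm j = tnth x j - dl.
    by rewrite tnth_mktuple; apply/max_idPl; rewrite subr_ge0 ltW.
  rewrite -(ltr_pM2r k0) => h; rewrite addrC -ltrBrDr (lt_le_trans h)//.
  rewrite [leRHS](_ : _ = (tnth x j - 2^-1 / (k n)%:R) * (k n)%:R); last first.
    by field; rewrite gt_eqF.
  rewrite ler_pM2r//.
  have : 2^-1 / (k n)%:R <= dl / 2.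
    by rewrite ler_pdivrMr// mulrAC -[leLHS]mul1r ler_pM2r ?invr_gt0// mulrC ltW.
  lra.
apply: (@le_trans _ _ (scaled_count X n (k n)
   (tail_region (X 0%N) (fun j => ratio n * tnth xp j)) w)); last first.
  by move: H3; rewrite ltr_distl => /andP[_]; move: lxp; lra.
apply: stdf_hat_le_count => j; rewrite -countE mulrC ler_pM2r//.
have := H1 j; rewrite ltr_distl => /andP[+ _]; rewrite tnth_mktuple; lra.
Unshelve. all: by end_near. Qed.

(** As in the Glivenko-Cantelli theorem: on a grid of mesh [1 / m], monotonicity traps both
    functions at [x] between their values at the opposite corners of a cell, and [l] varies by at
    most [d / m <= e / 2] between these. Finitely many pointwise events then suffice. *)
Lemma stdf_hat_uniform (e : R) : 0 < e ->
  whp P (fun n => [set w | forall x, unit_cube d x ->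
    `|stdf_hat X n (k n) w x - l x| <= e]).
Proof.
move=> e0; have e20 : 0 < e / 2 by rewrite divr_gt0.
pose m := (Num.truncn (d%:R / (e / 2))).+1.
have m0 : 0 < m%:R :> R by rewrite ltr0n.
have dm : d%:R / m%:R <= e / 2.
  by rewrite ler_pdivrMr// mulrC -ler_pdivrMr// ltW// truncnS_gt.
(* Lower corners use the numerators [0] to [m], the value [m] occurring when a coordinate is one;
   upper corners then reach [m.+1], whence [m.+2] values per axis. *)
pose y (a : {ffun 'I_d -> 'I_m.+2}) : d.-tuple R := [tuple (a j)%:R / m%:R | j < d].
have y0 a j : 0 <= tnth (y a) j by rewrite tnth_mktuple divr_ge0.
apply: whp_sub (whp_forall (fun a => stdf_hat_pointwise (y0 a) e20)) _ _.
  by move=> n; exact: (measurable_stdf_hat_event X n (k n)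
    (fun f => forall x, unit_cube d x -> `|f x - l x| <= e)).
apply: nearW => n w /= H x hx.
pose t j := Num.truncn (m%:R * tnth x j).
have xj0 j : 0 <= m%:R * tnth x j by rewrite mulr_ge0//; have /andP[] := hx j.
have t_le j : (t j)%:R <= m%:R * tnth x j by rewrite truncn_le.
have t_gt j : m%:R * tnth x j < (t j).+1%:R by exact: truncnS_gt.
have tm j : (t j <= m)%N.
  rewrite -(ler_nat R) (le_trans (t_le j))// ler_piMr//.
  by have /andP[] := hx j.
pose a : {ffun 'I_d -> 'I_m.+2} := [ffun j => inord (t j)].
pose b : {ffun 'I_d -> 'I_m.+2} := [ffun j => inord (t j).+1].
have aE j : tnth (y a) j = (t j)%:R / m%:R.
  by rewrite tnth_mktuple ffunE inordK// ltnS (leq_trans (tm j)).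
have bE j : tnth (y b) j = (t j).+1%:R / m%:R.
  by rewrite tnth_mktuple ffunE inordK// !ltnS.
have ax j : tnth (y a) j <= tnth x j by rewrite aE ler_pdivrMr// mulrC.
have xb j : tnth x j <= tnth (y b) j by rewrite bE ler_pdivlMr// mulrC ltW.
have x0 j : 0 <= tnth x j by have /andP[] := hx j.
have lab : l (y b) <= l (y a) + e / 2.
  apply: le_trans (@stdf_lipschitz _ _ _ _ _ _ _ cX hl (y a) (y b) _) _.
    by move=> j; rewrite y0 (le_trans (ax j)).
  rewrite lerD2l; apply: le_trans dm.
  under eq_bigr do rewrite aE bE -mulrBl -natr1 addrAC subrr add0r mul1r.
  by rewrite sumr_const card_ord mulr_natl.
have lax : l (y a) <= l x by apply: (stdf_homo cX hl) => // j; rewrite y0 ax.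
have lxb : l x <= l (y b) by apply: (stdf_homo cX hl) => // j; rewrite x0 xb.
have hax := stdf_hat_homo X n (k n) w ax.
have hxb := stdf_hat_homo X n (k n) w xb.
move: (H a) (H b); rewrite !ler_distl => /andP[h1 h2] /andP[h3 h4].
by apply/andP; split; lra.
Qed.

End consistency.

(** * Differential calculus on row vectors *)

Section matrix_norm.
Context (R : realType).

Lemma mx_entry_norm m n (v : 'M[R]_(m, n)) i j : `|v i j| <= `|v|.
Proof.
rewrite [leRHS]/Num.norm/= mx_normrE.
exact: (@le_bigmax _ _ _ 0 (fun ij => `|v ij.1 ij.2|) (i, j)).
Qed.

Lemma mx_norm_le m n (v : 'M[R]_(m, n)) (c : R) :
  0 <= c -> (forall i j, `|v i j| <= c) -> `|v| <= c.
Proof.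
move=> c0 vc; rewrite [leLHS]/Num.norm/= mx_normrE.
by apply: bigmax_le => // -[i j] _; exact: vc.
Qed.

Lemma norm_mulmx_le m n p (u : 'M[R]_(m, n)) (A : 'M[R]_(n, p)) :
  `|u *m A| <= n%:R * `|A| * `|u|.
Proof.
apply: mx_norm_le => [|i j]; first by rewrite !mulr_ge0.
rewrite mxE (le_trans (ler_norm_sum _ _ _))//.
rewrite -mulrA mulr_natl (_ : _ *+ n = \sum_(k < n) `|A| * `|u|); last first.
  by rewrite sumr_const card_ord.
apply: ler_sum => k _; by rewrite normrM mulrC; apply: ler_pM => //; exact: mx_entry_norm.
Qed.

End matrix_norm.

Section differential.
Context (R : realType).

Lemma is_derive_line (V W : normedModType R) (f : V -> W) (a v : V) (t : R) :
  differentiable f (a + t *: v) ->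
  is_derive t 1 (fun s => f (a + s *: v)) ('D_v f (a + t *: v)).
Proof.
move=> df.
have E : (fun h : R => h^-1 *: (((fun s => f (a + s *: v)) \o shift t) (h *: 1) -
      f (a + t *: v))) =
    (fun h => h^-1 *: ((f \o shift (a + t *: v)) (h *: v) - f (a + t *: v))).
  apply/funext => h /=; congr (_ *: (f _ - _)).
  by rewrite /shift /= scalerDl [h *: 1]mulr1 addrCA.
have dv := @diff_derivable _ _ _ f _ v df.
by split; rewrite /derivable /derive E.
Qed.

Lemma MVT_line (V : normedModType R) (f : V -> R) (a v : V) :
  (forall t, t \in `[0, 1] -> differentiable f (a + t *: v)) ->
  exists2 t, t \in `[0, 1] & f (a + v) - f a = 'D_v f (a + t *: v).
Proof.
move=> df.
pose g s := f (a + s *: v).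
have dg (t : R) : t \in `[0, 1] -> is_derive t 1 g ('D_v f (a + t *: v)).
  by move=> /df; exact: is_derive_line.
pose dg0 (t : R) : R := 'D_v f (a + t *: v).
have H1 (t : R) : t \in `]0, 1[ -> is_derive t 1 g (dg0 t).
  by move=> /subset_itv_oo_cc; exact: dg.
have H2 : {within `[0, 1], continuous g}.
  by apply: derivable_within_continuous => t /dg [].
have [t t01 H] := MVT_segment ler01 H1 H2.
by exists t => //; move: H; rewrite /g scale1r scale0r addr0 subr0 mulr1.
Qed.

Lemma derive_entry (p q : nat) (f : 'rV[R]_p -> 'rV[R]_q) x v i :
  differentiable f x -> 'D_v (fun y => f y ord0 i) x = 'D_v f x ord0 i.
Proof.
move=> df; rewrite (derive_mx (@diff_derivable _ _ _ f x v df)) mxE.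
by [].
Qed.

Lemma differentiable_entry (p q : nat) (f : 'rV[R]_p -> 'rV[R]_q) x i :
  differentiable f x -> differentiable (fun y => f y ord0 i) x.
Proof.
move=> df; apply: (@differentiable_comp _ _ _ _ f (fun N : 'rV_q => N ord0 i)) => //.
exact: differentiable_coord.
Qed.

Lemma derive_row (p : nat) (W : normedModType R) (f : 'rV[R]_p -> W) x v :
  differentiable f x ->
  'D_v f x = \sum_(j < p) v ord0 j *: 'D_('e_j) f x.
Proof.
move=> df; rewrite deriveE// [v in LHS]row_sum_delta linear_sum.
by apply: eq_bigr => j _; rewrite linearZ/= deriveE.
Qed.

Lemma segment_ball (V : normedModType R) (x a v : V) (r t : R) :
  `|x - a| < r -> `|x - (a + v)| < r -> t \in `[0, 1] -> `|x - (a + t *: v)| < r.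
Proof.
move=> ha hv; rewrite in_itv/= => /andP[t0 t1].
have -> : x - (a + t *: v) = (1 - t) *: (x - a) + t *: (x - (a + v)).
  rewrite !opprD !addrA; move: (x - a) => u.
  by rewrite scalerBl scale1r scalerBr addrA subrK.
apply: (le_lt_trans (ler_normD _ _)).
rewrite !normrZ [`|1 - t|]ger0_norm ?subr_ge0// [`|t|]ger0_norm//.
have [->|tn0] := eqVneq t 0; first by rewrite subr0 mul1r mul0r addr0.
apply: (@lt_le_trans _ _ ((1 - t) * r + t * r)); last by rewrite -mulrDl subrK mul1r.
apply: ler_ltD; first by rewrite ler_wpM2l ?subr_ge0// ltW.
by rewrite ltr_pM2l// lt_def tn0.
Qed.

(** Strict differentiability at [x]. The mean value theorem is applied entry by entry, as the
    intermediate point depends on the entry; expanding in basis directions leaves only [p]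
    continuity conditions, valid on a common ball. *)
Lemma C1_strict_diff (p q : nat) (A : set 'rV[R]_p) (f : 'rV[R]_p -> 'rV[R]_q)
    (x : 'rV[R]_p) (eta : R) :
  nbhs x A -> C1_on A f -> 0 < eta ->
  exists2 r : R, 0 < r & forall a b : 'rV[R]_p, `|x - a| < r -> `|x - b| < r ->
    `|f b - f a - 'D_(b - a) f x| <= eta * `|b - a|.
Proof.
move=> xA fA eta0.
have Ax : A x by exact: nbhs_singleton.
have eta'0 : 0 < eta / (p.+1%:R) by rewrite divr_gt0.
have : \forall y \near x, A y /\
    forall j : 'I_p, `|'D_('e_j) f x - 'D_('e_j) f y| < eta / p.+1%:R.
  apply: filterI; first exact: xA.
  apply: (@filter_forall _ _ _ (nbhs x)) => j.
  have /cvgrPdist_lt := (fA x Ax).2 'e_j.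
  exact.
move=> /nbhs_ballP[r /= r0 hr]; exists r => // a b ha hb.
have inr (c : 'rV[R]_p) : `|x - c| < r -> A c /\
    forall j : 'I_p, `|'D_('e_j) f x - 'D_('e_j) f c| < eta / p.+1%:R.
  by move=> hc; apply: hr; rewrite -ball_normE.
have bE : b = a + (b - a) by rewrite addrC subrK.
move: (b - a) bE => v bE.
apply: mx_norm_le => [|i0 i]; first by rewrite mulr_ge0// ltW.
rewrite ord1 {i0}.
have seg t : t \in `[0, 1] -> `|x - (a + t *: v)| < r.
  by apply: segment_ball => //; rewrite -bE.
have [t t01 H] := @MVT_line _ (fun y => f y ord0 i) a v
  (fun t ht => differentiable_entry i (fA _ (inr _ (seg t ht)).1).1).
have [Ac hc] := inr _ (seg t t01).
rewrite !mxE {1}bE H derive_entry; last exact: (fA _ Ac).1.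
rewrite (derive_row _ (fA _ Ac).1) (derive_row _ (fA _ Ax).1).
rewrite !summxE -sumrB (le_trans (ler_norm_sum _ _ _))//.
apply: (@le_trans _ _ (\sum_(j < p) `|v| * (eta / p.+1%:R))).
  apply: ler_sum => j _; rewrite !mxE -mulrBr normrM.
  apply: ler_pM => //; first exact: mx_entry_norm.
  rewrite distrC; apply: le_trans (ltW (hc j)).
  by apply: le_trans (mx_entry_norm _ ord0 i); rewrite !mxE.
rewrite sumr_const card_ord -[leLHS]mulr_natr -mulrA mulrC ler_wpM2r//.
rewrite -mulrA ler_piMr ?(ltW eta0)//.
by rewrite [leLHS]mulrC ler_pdivrMr// mul1r ler_nat.
Qed.

Lemma C1_lipschitz (p q : nat) (A : set 'rV[R]_p) (f : 'rV[R]_p -> 'rV[R]_q) (x : 'rV[R]_p) :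
  nbhs x A -> C1_on A f ->
  exists2 L : R, 0 <= L & exists2 r : R, 0 < r &
    forall a b : 'rV[R]_p, `|x - a| < r -> `|x - b| < r -> `|f b - f a| <= L * `|b - a|.
Proof.
move=> xA fA; have [r r0 hr] := C1_strict_diff xA fA ltr01.
have Ax : A x by exact: nbhs_singleton.
exists (1 + p%:R * `|'J f x|); first by rewrite addr_ge0// mulr_ge0.
exists r => // a b ha hb.
rewrite -[f b - f a](subrK ('D_(b - a) f x)) (le_trans (ler_normD _ _))//.
rewrite mulrDl lerD// ?hr// deriveEjacobian; last exact: (fA _ Ax).1.
exact: norm_mulmx_le.
Qed.

(** A right inverse [K] of the Jacobian, which acts on row vectors from the right, bounds the linear
    part below; strict differentiability transfers this to [f] near [x]. *)
Lemma C1_full_rank_expansive (p q : nat) (A : set 'rV[R]_p)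
    (f : 'rV[R]_p -> 'rV[R]_q) (x : 'rV[R]_p) :
  nbhs x A -> C1_on A f -> \rank ('J f x) = p ->
  exists2 c : R, 0 < c & exists2 r : R, 0 < r &
    forall a b : 'rV[R]_p, `|x - a| < r -> `|x - b| < r -> c * `|b - a| <= `|f b - f a|.
Proof.
move=> xA fA rk.
have Ax : A x by exact: nbhs_singleton.
have /row_freeP[K JK] : row_free ('J f x) by rewrite /row_free rk.
pose M := q%:R * `|K| + 1.
have M0 : 0 < M by rewrite ltr_wpDl// mulr_ge0.
(* The linear part expands by at least [M^-1 = 2 c]; one [c] absorbs the error of linearisation and
   the other remains. *)
pose c := (2 * M)^-1.
have c0 : 0 < c by rewrite invr_gt0 mulr_gt0.
have [r r0 hr] := C1_strict_diff xA fA c0.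
exists c => //; exists r => // a b ha hb.
set v := b - a.
have vJ : M^-1 * `|v| <= `|v *m 'J f x|.
  rewrite mulrC ler_pdivrMr// mulrC.
  rewrite -[X in `|X| <= _]mulmx1 -JK mulmxA (le_trans (norm_mulmx_le _ _))//.
  by rewrite ler_wpM2r// lerDl.
have := hr _ _ ha hb; rewrite deriveEjacobian; last exact: (fA _ Ax).1.
have := ler_normD (f b - f a) (v *m 'J f x - (f b - f a)).
rewrite addrC subrK [`|v *m _ - _|]distrC -/v.
have Mc : M^-1 = c + c by rewrite /c; field; rewrite gt_eqF.
rewrite Mc mulrDl in vJ; move: vJ; lra.
Qed.

(* Both halves of the segment from [a] to [b] are handled by the mean value
   theorem in the same direction; the derivatives at the two intermediate
   points differ by a Lipschitz amount. *)
Lemma C2_second_difference (p q : nat) (A : set 'rV[R]_p)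
    (f : 'rV[R]_p -> 'rV[R]_q) (x : 'rV[R]_p) :
  nbhs x A -> C2_on A f ->
  exists2 C : R, 0 <= C & exists2 r : R, 0 < r &
    forall a v : 'rV[R]_p, `|x - a| < r -> `|x - (a + v)| < r ->
      `|f (a + 2^-1 *: v) - 2^-1 *: (f a + f (a + v))| <= C * `|v| ^+ 2.
Proof.
move=> xA [f1 f2].
have : forall j : 'I_p, exists Lr : R * R, [/\ 0 <= Lr.1, 0 < Lr.2 &
    forall a b : 'rV[R]_p, `|x - a| < Lr.2 -> `|x - b| < Lr.2 ->
      `|'D_('e_j) f b - 'D_('e_j) f a| <= Lr.1 * `|b - a|].
  by move=> j; have [L L0 [r r0 H]] := C1_lipschitz xA (f2 'e_j); exists (L, r).
move=> /choice[Lr HLr].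
have /nbhs_ballP[r0 /= r00 hA] := xA.
pose r := \big[Num.min/r0]_j (Lr j).2.
have rr0 : 0 < r by apply/bigmin_gtP; split => // j _; have [] := HLr j.
pose L := \sum_j (Lr j).1.
have L0 : 0 <= L by apply: sumr_ge0 => j _; have [] := HLr j.
exists L => //; exists r => // a v ha hv.
have seg t : t \in `[0, 1] -> `|x - (a + t *: v)| < r by exact: segment_ball.
have df t : t \in `[0, 1] -> differentiable f (a + t *: v).
  move=> /seg h; apply: (f1 _ _).1; apply: hA; rewrite -ball_normE.
  by rewrite /= (lt_le_trans h)// bigmin_le_id.
apply: mx_norm_le => [|i0 i]; first by rewrite mulr_ge0// sqr_ge0.
rewrite ord1 {i0}.
have [w wE] : exists w, w = 2^-1 *: v by exists (2^-1 *: v).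
rewrite -wE.
have half1 (t : R) : t \in `[0, 1] -> t * 2^-1 \in `[0, 1].
  rewrite !in_itv/= => /andP[? ?]; lra.
have half2 (t : R) : t \in `[0, 1] -> 2^-1 + t * 2^-1 \in `[0, 1].
  rewrite !in_itv/= => /andP[? ?]; lra.
have E1 t : a + t *: w = a + (t * 2^-1) *: v by rewrite wE scalerA.
have E2 t : a + w + t *: w = a + (2^-1 + t * 2^-1) *: v.
  by rewrite wE scalerA scalerDl addrA.
have [t1 t101] : exists2 t, t \in `[0, 1] & f (a + w) ord0 i - f a ord0 i =
    'D_w (fun y => f y ord0 i) (a + t *: w).
  apply: MVT_line => t ht; apply: differentiable_entry.
  by rewrite E1; apply: df; exact: half1.
have [t2 t201] : exists2 t, t \in `[0, 1] & f (a + w + w) ord0 i - f (a + w) ord0 i =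
    'D_w (fun y => f y ord0 i) (a + w + t *: w).
  apply: MVT_line => t ht; apply: differentiable_entry.
  by rewrite E2; apply: df; exact: half2.
have d1 := df _ (half1 _ t101); have d2 := df _ (half2 _ t201).
rewrite E1 E2 !derive_entry// !(derive_row _ d1) !(derive_row _ d2) !summxE.
have -> : a + w + w = a + v.
  rewrite -addrA wE -scalerDl (_ : 2^-1 + 2^-1 = 1) ?scale1r//; by field.
move=> H2 H1.
have -> : (f (a + w) - 2^-1 *: (f a + f (a + v))) ord0 i =
    2^-1 * ((f (a + w) ord0 i - f a ord0 i) - (f (a + v) ord0 i - f (a + w) ord0 i)).
  by rewrite !mxE; field.
rewrite H1 H2 -sumrB normrM ger0_norm//.
apply: (@le_trans _ _ (\sum_j (Lr j).1 * `|v| ^+ 2)); last by rewrite mulr_suml.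
apply: (@le_trans _ _ (1 * `| \sum_j
   ((w ord0 j *: 'D_'e_j f (a + (t1 * 2^-1) *: v)) ord0 i -
    (w ord0 j *: 'D_'e_j f (a + (2^-1 + t2 * 2^-1) *: v)) ord0 i) |)).
  by rewrite ler_wpM2r// invf_le1// ler1n.
rewrite mul1r (le_trans (ler_norm_sum _ _ _))//; apply: ler_sum => j _.
have [L0j r0j HL] := HLr j.
have wv : `|w| <= `|v|.
  by rewrite wE normrZ ger0_norm// ler_piMl// invf_le1// ler1n.
rewrite !mxE -mulrBr normrM expr2 mulrA mulrC.
apply: ler_pM => //; last first.
  by rewrite (le_trans _ wv)// mx_entry_norm.
apply: (@le_trans _ _ `|'D_'e_j f (a + (t1 * 2^-1) *: v) -
    'D_'e_j f (a + (2^-1 + t2 * 2^-1) *: v)|).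
  by apply: le_trans (mx_entry_norm _ ord0 i); rewrite !mxE.
apply: le_trans (HL _ _ _ _) _.
- by apply: lt_le_trans (seg _ (half2 _ t201)) _; exact: bigmin_le.
- by apply: lt_le_trans (seg _ (half1 _ t101)) _; exact: bigmin_le.
rewrite ler_wpM2l// opprD addrACA subrr add0r -scalerBl normrZ.
rewrite ler_piMl// ler_norml; move: t101 t201; rewrite !in_itv/=.
by move=> /andP[? ?] /andP[? ?]; lra.
Qed.

End differential.

(** * Nearest points in a parametric image *)

Section euclidean_norm.
Context (R : realType) (n : nat).
Implicit Types v : 'rV[R]_n.

Lemma enorm_sqr v : enorm v ^+ 2 = \sum_(j < n) v ord0 j ^+ 2.
Proof. by rewrite sqr_sqrtr// sumr_ge0// => j _; exact: sqr_ge0. Qed.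

Lemma enorm_ge0 v : 0 <= enorm v.
Proof. exact: sqrtr_ge0. Qed.

Lemma normr_le_enorm v : `|v| <= enorm v.
Proof.
apply: mx_norm_le => [|i j]; first exact: enorm_ge0.
rewrite ord1 -ler_sqr ?nnegrE ?enorm_ge0// enorm_sqr real_normK ?num_real//.
by rewrite (bigD1 j)//= lerDl sumr_ge0// => k _; exact: sqr_ge0.
Qed.

Lemma enorm_le_normr v : enorm v <= n%:R * `|v|.
Proof.
rewrite -ler_sqr ?nnegrE ?enorm_ge0// ?mulr_ge0// enorm_sqr.
apply: (@le_trans _ _ (\sum_(j < n) `|v| ^+ 2)).
  apply: ler_sum => j _; rewrite -real_normK ?num_real// ler_sqr ?nnegrE//.
  exact: mx_entry_norm.
rewrite sumr_const card_ord -[leLHS]mulr_natl exprMn; apply: ler_wpM2r.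
  exact: sqr_ge0.
by rewrite -natrX ler_nat; case: n => // m; rewrite expnS expn1 leq_pmulr.
Qed.

Lemma enorm_sqr_continuous : continuous (fun v => enorm v ^+ 2).
Proof.
have -> : (fun v => enorm v ^+ 2) = (fun v => \sum_(j < n) v ord0 j ^+ 2).
  by apply/funext => v; exact: enorm_sqr.
move=> v; apply: cvg_big => [||j _]; [exact: add_continuous|exact: nbhs_filter|].
apply: (@continuous_comp _ _ _ (fun w : 'rV[R]_n => w ord0 j) (fun z => z ^+ 2)).
  exact: coord_continuous.
exact: exprn_continuous.
Qed.

Lemma enorm_le_sqr v (e : R) : 0 <= e -> (enorm v <= e) = (enorm v ^+ 2 <= e ^+ 2).
Proof. by move=> e0; rewrite ler_sqr ?nnegrE// enorm_ge0. Qed.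

End euclidean_norm.

Section minimum_distance.
Context (R : realType) (p q : nat).
Variables (Theta : set 'rV[R]_p) (f : 'rV[R]_p -> 'rV[R]_q) (theta0 : 'rV[R]_p).
Hypothesis htheta0 : Theta theta0.

(** With [phi] for [f] and the weighted integral of the estimator for [T] this is [minimizers]; the
    sample enters through [T] alone. *)
Definition nearest (T : 'rV[R]_q) : set 'rV[R]_p :=
  [set theta | Theta theta /\ forall theta', Theta theta' ->
     enorm (f theta - T) ^+ 2 <= enorm (f theta' - T) ^+ 2].

(** Continuity of the inverse at [f theta0] gives a [d] such that parameters beyond [eps] have
    images at distance at least [d]. For [T] close enough they are strictly worse than [theta0], so
    the minimization reduces to the compact set [K]. *)
Lemma nearest_consistent (eps0 eps : R) :
  homeomorphism_on Theta f ->
  closed [set theta | Theta theta /\ enorm (theta - theta0) <= eps0] ->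
  0 < eps <= eps0 ->
  exists2 delta : R, 0 < delta & forall T, `|f theta0 - T| <= delta ->
    nearest T !=set0 /\
    nearest T `<=` [set theta | Theta theta /\ enorm (theta - theta0) <= eps].
Proof.
move=> [cf [h [ch hK]]] cl /andP[e0 ee0].
pose K := [set theta | Theta theta /\ enorm (theta - theta0) <= eps].
have clK : closed K.
  have -> : K = [set theta | Theta theta /\ enorm (theta - theta0) <= eps0] `&`
      [set theta | enorm (theta - theta0) <= eps].
    apply/seteqP; split => x /=; last by move=> [[]].
    by move=> [Tx xe]; split => //; split => //; exact: le_trans ee0.
  apply: closedI => //.
  have -> : [set theta | enorm (theta - theta0) <= eps] =
      (fun theta => enorm (theta - theta0) ^+ 2) @^-1` [set x | x <= eps ^+ 2].
    by apply/seteqP; split => x /=; rewrite enorm_le_sqr// ltW.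
  apply: preimage_closed; last exact: closed_le.
  move=> x _; apply: (@continuous_comp _ _ _ (fun v : 'rV[R]_p => v - theta0)
    (fun v : 'rV[R]_p => enorm v ^+ 2)); last exact: enorm_sqr_continuous.
  by apply: continuousB; [exact: cvg_id|exact: cst_continuous].
have bdK : bounded_set K.
  exists (`|theta0| + eps); split; first exact: num_real.
  move=> M ltM x [_ xe]; apply: ltW; apply: le_lt_trans ltM.
  rewrite -[x](subrK theta0) addrC (le_trans (ler_normD _ _))// lerD2l.
  exact: le_trans (normr_le_enorm _) xe.
have cK := bounded_closed_compact bdK clK.
have [d d0 hd] : exists2 d : R, 0 < d & forall theta, Theta theta ->
    `|f theta0 - f theta| < d -> enorm (theta - theta0) <= eps.
  have e'0 : 0 < eps / p.+1%:R by rewrite divr_gt0.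
  have := (subspace_continuousP _ _).1 ch (f theta0).
  have fT : (f @` Theta) (f theta0) by exists theta0.
  move=> /(_ fT) /cvgrPdist_lt /(_ _ e'0).
  rewrite /from_subspace hK// => /nbhs_ballP[d /= d0 hd]; exists d => // theta Tth.
  move=> fd; have := hd (f theta); rewrite -ball_normE /= => /(_ fd).
  have fT' : (f @` Theta) (f theta) by exists theta.
  move=> /(_ fT'); rewrite hK// distrC => /ltW H.
  rewrite (le_trans (enorm_le_normr _))// (le_trans (ler_wpM2l _ H))//.
  rewrite mulrCA ler_piMr// ?(ltW e0)//.
  by rewrite ler_pdivrMr// mul1r ler_nat.
(* The Euclidean distance from [f theta0] to [T] is at most [q * delta], whereas a far image is at
   distance at least [d - delta], that is [(q + 1) * delta], from [T], even in the supremum norm. *)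
pose delta := d / (q.+2)%:R.
have delta0 : 0 < delta by rewrite divr_gt0.
exists delta => // T hT.
have K0 : K theta0.
  split => //; rewrite subrr (le_trans (enorm_le_normr _))// normr0 mulr0.
  exact: ltW.
have far theta : Theta theta -> ~ enorm (theta - theta0) <= eps ->
    enorm (f theta0 - T) ^+ 2 < enorm (f theta - T) ^+ 2.
  move=> Tth nle; rewrite ltr_sqr ?nnegrE ?enorm_ge0//.
  apply: (@le_lt_trans _ _ (q%:R * delta)).
    by rewrite (le_trans (enorm_le_normr _))// ler_wpM2l.
  apply: lt_le_trans (normr_le_enorm _).
  have dle : d <= `|f theta0 - f theta|.
    by rewrite leNgt; apply/negP => /hd; apply: contra_not nle; exact.
  have := ler_normB (f theta0 - T) (f theta - T).
  rewrite opprB addrA subrK => tri.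
  have : d = (q%:R + 2) * delta.
    by rewrite /delta -natrD addn2 mulrC divfK// pnatr_eq0.
  move: delta0 hT dle tri; rewrite mulrDl; lra.
have cQ : {within K, continuous (fun theta => enorm (f theta - T) ^+ 2)}.
  have cfK : {within K, continuous f} by apply: continuous_subspaceW cf => x [].
  move=> x; apply: (@continuous_comp _ _ _ (f : subspace K -> _)
    (fun v : 'rV[R]_q => enorm (v - T) ^+ 2)); first exact: cfK.
  apply: (@continuous_comp _ _ _ (fun v : 'rV[R]_q => v - T)
    (fun v : 'rV[R]_q => enorm v ^+ 2)); last exact: enorm_sqr_continuous.
  by apply: continuousB; [exact: cvg_id|exact: cst_continuous].
have [c cK' cmin] := EVT_min_rV (ex_intro _ theta0 K0) cK cQ.
move: cK'; rewrite inE => -[Tc ce].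
split.
  exists c; split => // theta Tth.
  have [le|/(far _ Tth)] := pselect (enorm (theta - theta0) <= eps).
    by apply: cmin; rewrite inE.
  move=> /ltW; apply: le_trans.
  by apply: cmin; rewrite inE.
move=> theta [Tth hmin]; split => //; apply: contrapT => /(far _ Tth).
rewrite ltNge => /negP; apply.
exact: hmin.
Qed.
End minimum_distance.

Section uniqueness.
Context (R : realType) (p q : nat).

(* The parallelogram law at the midpoint [m] of two equally good points [a]
   and [b] gains [|f a - f b|^2 / 4], of order [|b - a|^2], over the common
   value; the nonlinearity of [f] only costs [o(|b - a|^2)] since the residuals
   are small. *)
Lemma midpoint_improves (A : set 'rV[R]_p) (f : 'rV[R]_p -> 'rV[R]_q)
    (x : 'rV[R]_p) :
  nbhs x A -> C2_on A f -> \rank ('J f x) = p ->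
  exists2 r : R, 0 < r & forall T (a b : 'rV[R]_p), `|f x - T| < r ->
    `|x - a| < r -> `|x - b| < r -> a != b ->
    enorm (f a - T) ^+ 2 = enorm (f b - T) ^+ 2 ->
    exists2 m, A m & enorm (f m - T) ^+ 2 < enorm (f a - T) ^+ 2.
Proof.
move=> xA C2f rk; have [C1f _] := C2f.
have [c c0 [r1 r10 H1]] := C1_full_rank_expansive xA C1f rk.
have [C C0 [r2 r20 H2]] := C2_second_difference xA C2f.
have [L L0 [r3 r30 H3]] := C1_lipschitz xA C1f.
have /nbhs_ballP[r0 /= r00 hA] := xA.
(* Chosen so that [D * r <= c ^+ 2] brings the cross term strictly below [4^-1 * (c * |v|) ^+ 2];
   the final [+ 1] makes [D] positive and the comparison strict. *)
pose D := 4 * (2 * (L + 1) * C + 4 * C ^+ 2) * q%:R + 1.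
have D0 : 0 < D.
  by rewrite ltr_wpDl// !mulr_ge0// addr_ge0// !mulr_ge0// ?addr_ge0// sqr_ge0.
pose r := Num.min (Num.min (Num.min r0 r1) (Num.min r2 r3)) (Num.min 1 (c ^+ 2 / D)).
have rr0 : 0 < r by rewrite !lt_min r00 r10 r20 r30 ltr01/= divr_gt0// exprn_gt0.
have rl : [/\ r <= r0, r <= r1, r <= r2, r <= r3 & r <= 1 /\ r <= c ^+ 2 / D].
  have : r <= r by []. rewrite {2}/r !le_min.
  by move=> /andP[/andP[/andP[? ?] /andP[? ?]] /andP[? ?]].
have [rle0 rle1 rle2 rle3 [rle4 rle5]] := rl.
exists r => // T a b fT ha hb ab Qab.
pose v := b - a.
have bE : a + v = b by rewrite /v addrC subrK.
have v0 : 0 < `|v| by rewrite normr_gt0 subr_eq0 eq_sym.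
exists (a + 2^-1 *: v).
  apply: hA; rewrite -ball_normE /=; apply: lt_le_trans rle0.
  apply: segment_ball => //; first by rewrite bE.
  by rewrite in_itv/= invr_ge0 ler0n invf_le1// ler1n.
set m := a + _.
pose e := f m - 2^-1 *: (f a + f b).
have ee : `|e| <= C * `|v| ^+ 2.
  rewrite /e /m -bE; apply: H2; first exact: lt_le_trans rle2.
  by rewrite bE; exact: lt_le_trans rle2.
have vr : `|v| <= 2 * r.
  rewrite /v -(subrK x b) -addrA (le_trans (ler_normD _ _))// distrC.
  by rewrite mulr_natl mulr2n lerD// ltW.
have res u : `|x - u| < r -> `|f u - T| <= (L + 1) * r.
  move=> hu; rewrite -(subrK (f x) (f u)) -addrA (le_trans (ler_normD _ _))//.
  rewrite mulrDl mul1r lerD//; last exact: ltW.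
  have := H3 x u; rewrite subrr normr0 => /(_ r30 (lt_le_trans hu rle3)).
  move=> /le_trans; apply; rewrite ler_wpM2l// distrC; exact: ltW.
have fab : (c * `|v|) ^+ 2 <= \sum_j (f a ord0 j - f b ord0 j) ^+ 2.
  have -> : \sum_j (f a ord0 j - f b ord0 j) ^+ 2 = enorm (f b - f a) ^+ 2.
    rewrite enorm_sqr; apply: eq_bigr => j _; rewrite !mxE; ring.
  rewrite ler_sqr ?nnegrE ?enorm_ge0//; last by rewrite mulr_ge0// ltW.
  apply: le_trans (normr_le_enorm _); apply: H1; exact: lt_le_trans rle1.
(* Exact expansion of [f m - T] as the mean of the two residuals plus [e]: the parallelogram law
   gives the gain, and the last sum collects all terms that contain [e]. *)
have Qm : enorm (f m - T) ^+ 2 = enorm (f a - T) ^+ 2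
    - 4^-1 * \sum_j (f a ord0 j - f b ord0 j) ^+ 2
    + \sum_j (((f a - T) ord0 j + (f b - T) ord0 j + e ord0 j) * e ord0 j).
  have Qh : enorm (f a - T) ^+ 2 =
      2^-1 * (enorm (f a - T) ^+ 2 + enorm (f b - T) ^+ 2) by rewrite -Qab; field.
  rewrite [X in _ = X - _ + _]Qh.
  rewrite !enorm_sqr -big_split/= !mulr_sumr -sumrB -big_split/=.
  by apply: eq_bigr => j _; rewrite /e !mxE; field.
have cross : \sum_j (((f a - T) ord0 j + (f b - T) ord0 j + e ord0 j) * e ord0 j)
    <= q%:R * ((2 * ((L + 1) * r) + C * `|v| ^+ 2) * (C * `|v| ^+ 2)).
  rewrite mulr_natl (_ : _ *+ q = \sum_(j < q)
      ((2 * ((L + 1) * r) + C * `|v| ^+ 2) * (C * `|v| ^+ 2))); last first.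
    by rewrite sumr_const card_ord.
  apply: ler_sum => j _.
  rewrite (le_trans (ler_norm _))// normrM; apply: ler_pM => //; last first.
    exact: le_trans (mx_entry_norm _ _ _) ee.
  rewrite (le_trans (ler_normD _ _))// lerD//; last first.
    exact: le_trans (mx_entry_norm _ _ _) ee.
  rewrite (le_trans (ler_normD _ _))// mulr_natl mulr2n lerD//.
    exact: le_trans (mx_entry_norm _ _ _) (res _ ha).
  exact: le_trans (mx_entry_norm _ _ _) (res _ hb).
rewrite Qm.
suff : q%:R * ((2 * ((L + 1) * r) + C * `|v| ^+ 2) * (C * `|v| ^+ 2)) <
    4^-1 * (c * `|v|) ^+ 2 by move: cross fab; lra.
have v2 : 0 < `|v| ^+ 2 by rewrite exprn_gt0.
(* One factor is bounded by [2 * r] and the other by [2], using [r <= 1], so that the quadratic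
   error becomes linear in [r]. *)
have v2r : `|v| ^+ 2 <= 2 * r * 2.
  rewrite expr2; apply: ler_pM => //; rewrite (le_trans vr)//.
  by rewrite -[leRHS]mulr1 ler_wpM2l.
rewrite exprMn; move: (`|v| ^+ 2) v2 v2r => s s0 sr.
have -> : 4^-1 * (c ^+ 2 * s) = 4^-1 * c ^+ 2 * s by ring.
have -> : q%:R * ((2 * ((L + 1) * r) + C * s) * (C * s)) =
    q%:R * (2 * ((L + 1) * r) + C * s) * C * s by ring.
rewrite ltr_pM2r//.
have Dr : D * r <= c ^+ 2 by rewrite mulrC -ler_pdivlMr.
apply: (@le_lt_trans _ _ (q%:R * (2 * ((L + 1) * r) + C * (2 * r * 2)) * C)).
  by rewrite ler_wpM2r// ler_wpM2l// lerD2l ler_wpM2l.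
move: Dr; rewrite /D; lra.
Qed.

End uniqueness.

(** * Integration against the weight function *)

Lemma integrable_mul_bounded (R : realType) (dT : measure_display)
    (T : measurableType dT) (mu : {measure set T -> \bar R}) (D : set T)
    (g f : T -> R) (M : R) :
  measurable D -> mu.-integrable D (EFin \o g) -> measurable_fun D f ->
  (forall x, D x -> `|f x| <= M) ->
  mu.-integrable D (EFin \o (fun x => g x * f x)).
Proof.
move=> mD ig mf fM.
have mg : measurable_fun D g by apply/measurable_EFinP; exact: measurable_int ig.
apply: (le_integrable mD _ _ (integrableZl mD `|M| ig)).
  by apply/measurable_EFinP; exact: measurable_funM.
move=> x Dx; rewrite /= lee_fin !normrM mulrC ler_wpM2r// normr_id.
by rewrite (le_trans (fM x Dx))// ler_norm.
Qed.

Lemma Rintegral_mul_diff_le (R : realType) (dT : measure_display)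
    (T : measurableType dT) (mu : {measure set T -> \bar R}) (D : set T)
    (g f1 f2 : T -> R) (M s : R) :
  measurable D -> mu.-integrable D (EFin \o g) ->
  measurable_fun D f1 -> measurable_fun D f2 ->
  (forall x, D x -> `|f1 x| <= M) -> (forall x, D x -> `|f1 x - f2 x| <= s) ->
  `|\int[mu]_(x in D) (g x * f1 x) - \int[mu]_(x in D) (g x * f2 x)|
    <= s * \int[mu]_(x in D) `|g x|.
Proof.
move=> mD ig mf1 mf2 f1M f12.
have f2M x : D x -> `|f2 x| <= M + s.
  move=> Dx; rewrite -(subKr (f1 x) (f2 x)) (le_trans (ler_normB _ _))//.
  by rewrite lerD ?f1M ?f12.
have i1 := integrable_mul_bounded mD ig mf1 f1M.
have i2 := integrable_mul_bounded mD ig mf2 f2M.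
have i12 := integrable_mul_bounded mD ig (measurable_funB mf1 mf2) f12.
have ing : mu.-integrable D (EFin \o (fun x => `|g x|)) by exact: integrable_norm.
rewrite -RintegralB//.
under [in leLHS]eq_Rintegral do rewrite -mulrBr.
apply: (le_trans (le_normr_Rintegral mD i12)).
rewrite -RintegralZl//; apply: le_Rintegral => //.
- exact: integrable_norm.
- exact: (integrableZl mD s ing).
- by move=> x Dx; rewrite normrM mulrC ler_wpM2r// f12.
Qed.

Section borel_lebesgue_measurability.
Context (R : realType) (d : nat).

Let T : measurableType _ := caratheodory_type ((@borel_lebesgue R d)^*)%mu.

(** Integrals against [g] live on the completed sigma-algebra, while the measurability of [l] and of
    the estimator is proved for Borel sets. *)
Lemma borel_lebesgue_measurable (A : set (d.-tuple R)) :
  measurable A -> measurable (A : set T).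
Proof. by move=> mA; apply: sub_caratheodory; exact: sub_sigma_algebra. Qed.

Lemma borel_lebesgue_measurable_fun (D : set (d.-tuple R)) (f : d.-tuple R -> R) :
  measurable D -> measurable_fun D f -> measurable_fun (D : set T) f.
Proof.
move=> mD mf _ B mB; apply: borel_lebesgue_measurable; exact: mf.
Qed.

Lemma measurable_unit_cube : measurable (@unit_cube R d).
Proof.
apply: (@measurable_forall_tuple _ _ (fun=> `[0, 1]%classic)) => j.
exact: measurable_itv.
Qed.

(* By monotonicity and continuity a sublevel set is the union of the boxes
   below its rational points. *)
Lemma stdf_like_measurable (D : set (d.-tuple R)) (l : d.-tuple R -> R) :
  measurable D -> (forall x, D x -> forall j, 0 <= tnth x j) ->
  (forall x y, (forall j, 0 <= tnth x j <= tnth y j) -> l x <= l y) ->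
  (forall x y, (forall j, 0 <= tnth x j <= tnth y j) ->
     l y <= l x + \sum_j (tnth y j - tnth x j)) ->
  measurable_fun D l.
Proof.
move=> mD D0 lh ll; apply: measurable_fun_lt => c.
pose rt (a : d.-tuple rat) : d.-tuple R := [tuple ratr (tnth a j) | j < d].
rewrite (_ : _ `&` _ = D `&` \bigcup_(a in [set a | l (rt a) < c])
    lower_orthant (\row_j tnth (rt a) j)).
  apply: measurableI => //; rewrite bigcup_mkcond.
  apply: countable_bigcupT_measurable => [|a]; first exact: countableP.
  by case: ifP => // _; exact: measurable_lower_orthant.
apply/seteqP; split => x [Dx] /=; last first.
  move=> [a /= la xa]; split => //; apply: le_lt_trans la.
  by apply: lh => j; rewrite D0//=; have := xa j; rewrite mxE.
move=> lxc; split => //.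
pose eta := (c - l x) / d.+1%:R.
have eta0 : 0 < eta by rewrite divr_gt0// subr_gt0.
have : forall j, exists q : rat, tnth x j < ratr q < tnth x j + eta.
  move=> j; have /rat_in_itvoo[q] : tnth x j < tnth x j + eta by rewrite ltrDl.
  by rewrite in_itv; exists q.
move=> /choice[q hq].
exists [tuple q j | j < d] => /=; last first.
  by move=> j; rewrite mxE !tnth_mktuple; have /andP[/ltW] := hq j.
apply: le_lt_trans (ll x _ _) _.
  by move=> j; rewrite D0//= !tnth_mktuple; have /andP[/ltW] := hq j.
rewrite -ltrBrDl; apply: (@le_lt_trans _ _ (\sum_(j < d) eta)).
  apply: ler_sum => j _; rewrite !tnth_mktuple lerBlDl.
  by have /andP[_ /ltW] := hq j.
rewrite sumr_const card_ord -[ltLHS]mulr_natl /eta mulrCA.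
rewrite gtr_pMr ?subr_gt0// ltr_pdivrMr// mul1r ltr_nat//.
Qed.

End borel_lebesgue_measurability.

(** * Minimizers of the criterion *)

Lemma weighted_integral_diff_le (R : realType) (d q : nat)
    (g : d.-tuple R -> 'rV[R]_q) (f1 f2 : d.-tuple R -> R) (M s : R) :
  (forall i : 'I_q, (lebesgue_tuple d).-integrable (unit_cube d)
                      (fun x => (g x ord0 i)%:E)) ->
  measurable_fun (unit_cube d) f1 -> measurable_fun (unit_cube d) f2 ->
  (forall x, unit_cube d x -> `|f1 x| <= M) ->
  0 <= s -> (forall x, unit_cube d x -> `|f1 x - f2 x| <= s) ->
  `|weighted_integral g f1 - weighted_integral g f2| <=
    s * \sum_i \int[lebesgue_tuple d]_(x in unit_cube d) `|g x ord0 i|.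
Proof.
move=> ig mf1 mf2 f1M s0 f12.
have I0 i : 0 <= \int[lebesgue_tuple d]_(x in unit_cube d) `|g x ord0 i|.
  by apply: Rintegral_ge0.
apply: mx_norm_le => [|i0 i]; first by rewrite mulr_ge0// sumr_ge0.
rewrite ord1 {i0} !mxE.
apply: (@le_trans _ _ (s * \int[lebesgue_tuple d]_(x in unit_cube d) `|g x ord0 i|)).
  have mC := @measurable_unit_cube R d.
  apply: (Rintegral_mul_diff_le _ (ig i) _ _ f1M f12).
  - exact: borel_lebesgue_measurable.
  - exact: borel_lebesgue_measurable_fun.
  - exact: borel_lebesgue_measurable_fun.
by rewrite ler_wpM2l// (bigD1 i)//= lerDl sumr_ge0.
Qed.

Section estimator.
Context (R : realType) (dO : measure_display) (O : measurableType dO).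
Variables (P : probability O R) (d : nat) (X : nat -> {RV P >-> d.-tuple R}).

Lemma measurable_stdf_hat n k w D : measurable_fun D (stdf_hat X n k w).
Proof.
apply: measurable_funM => //; apply: measurable_sum => i.
pose A j := [set x : d.-tuple R |
  n%:R + 2^-1 - k%:R * tnth x j < (Defs.rank X i j w)%:R].
have -> : (fun x : d.-tuple R => [exists j, n%:R + 2^-1 - k%:R * tnth x j <
    (Defs.rank X i j w)%:R]%:R : R) = \1_[set x | exists j, A j x].
  apply/funext => x; rewrite indicE; congr ((nat_of_bool _)%:R).
  by apply/existsP/idP; rewrite inE.
apply: measurable_indic; apply: measurable_exists => j.
rewrite -[Y in measurable Y]setTI; apply: measurable_fun_ltr => //.
apply: measurable_funB => //; apply: measurable_funM => //.
exact: measurable_tnth.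
Qed.

Variables (q : nat) (g : d.-tuple R -> 'rV[R]_q) (l : d.-tuple R -> R).
Variable k : nat -> nat.
Hypothesis hindep : mutually_independent X.
Hypothesis hdf : forall i, joint_df (X i) = joint_df (X 0%N).
Hypothesis cX : continuous (joint_df (X 0%N)).
Hypothesis hl : has_stdf (X 0%N) l.
Hypothesis hg : forall i : 'I_q, (lebesgue_tuple d).-integrable (unit_cube d)
                             (fun x => (g x ord0 i)%:E).
Hypothesis hk : forall n, (1 <= n)%N -> (1 <= k n <= n)%N.
Hypothesis koo : k n @[n --> \oo] --> \oo.
Hypothesis hkn : (k n)%:R / n%:R @[n --> \oo] --> (0 : R).

(** The uniform error on the cube is multiplied by the total [L^1] norm of [g]. *)
Lemma weighted_integral_consistent (e : R) : 0 < e ->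
  whp P (fun n => [set w | `|weighted_integral g l -
    weighted_integral g (stdf_hat X n (k n) w)| <= e]).
Proof.
move=> e0.
pose M := \sum_i \int[lebesgue_tuple d]_(x in unit_cube d) `|g x ord0 i|.
have M0 : 0 <= M by apply: sumr_ge0 => i _; exact: Rintegral_ge0.
have M1 : 0 < M + 1 by rewrite ltr_wpDl.
(* Adding one to the total norm [M] avoids a division by zero when [g] vanishes. *)
have s0 : 0 < e / (M + 1) by rewrite divr_gt0.
have law i A (mA : measurable A) := eq_joint_df_law (hdf i) mA.
apply: whp_sub (stdf_hat_uniform hindep law cX hl hk koo hkn s0) _ _.
  by move=> n; exact: (measurable_stdf_hat_event X n (k n)
    (fun f => `|weighted_integral g l - weighted_integral g f| <= e)).
apply: nearW => n w /= hw.
have cube0 x : unit_cube d x -> forall j, 0 <= tnth x j.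
  by move=> hx j; have /andP[] := hx j.
have ml : measurable_fun (unit_cube d) l.
  apply: stdf_like_measurable => //; first exact: measurable_unit_cube.
  - exact: cube0.
  - exact: (stdf_homo cX hl).
  - exact: (stdf_lipschitz cX hl).
pose c (z : R) : d.-tuple R := [tuple z | _ < d].
(* Since [g] is only integrable, [l] must be bounded for the product to be integrable; monotonicity
   bounds it by its values at the two extreme corners of the cube. *)
have lM x : unit_cube d x -> `|l x| <= `|l (c 0)| + `|l (c 1)|.
  move=> hx.
  have h0 : l (c 0) <= l x.
    by apply: (stdf_homo cX hl) => j; rewrite tnth_mktuple lexx cube0.
  have h1 : l x <= l (c 1).
    by apply: (stdf_homo cX hl) => j; rewrite tnth_mktuple.
  rewrite ler_norml; apply/andP; split.
    have := ler_norm (- l (c 0)); rewrite normrN; have := normr_ge0 (l (c 1)); lra.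
  have := ler_norm (l (c 1)); have := normr_ge0 (l (c 0)); lra.
have hw' x : unit_cube d x -> `|l x - stdf_hat X n (k n) w x| <= e / (M + 1).
  by move=> hx; rewrite distrC; exact: hw.
apply: le_trans (weighted_integral_diff_le hg ml
  (@measurable_stdf_hat n (k n) w _) lM (ltW s0) hw') _.
rewrite -/M -mulrA ler_piMr ?(ltW e0)// mulrC ler_pdivrMr// mul1r lerDl//.
Qed.

End estimator.

(** Consistency places all minimizers in the ball where [midpoint_improves] applies. Two distinct
    ones would have the same criterion value, and some point of the interior of [Theta] would do
    strictly better. *)
Lemma nearest_unique (R : realType) (p q : nat) (Theta : set 'rV[R]_p)
    (f : 'rV[R]_p -> 'rV[R]_q) (theta0 : 'rV[R]_p) (eps0 e : R) :
  homeomorphism_on Theta f ->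
  closed [set theta | Theta theta /\ enorm (theta - theta0) <= eps0] ->
  0 < eps0 -> Theta° theta0 -> C2_on Theta° f -> \rank ('J f theta0) = p ->
  0 < e ->
  exists2 delta : R, 0 < delta & forall T, `|f theta0 - T| <= delta ->
    (exists! theta, nearest Theta f T theta) /\
    nearest Theta f T `<=` [set theta | enorm (theta - theta0) <= e].
Proof.
move=> hom cl eps00 int C2f rk e0.
have nb : nbhs theta0 Theta° by exact: open_nbhs_nbhs (conj (open_interior _) int).
have Th0 : Theta theta0 := interior_subset int.
have [r r0 improve] := midpoint_improves nb C2f rk.
(* The three bounds serve [nearest_consistent], the ball of radius [r], and the requested accuracy
   [e]. *)
pose eps := Num.min eps0 (Num.min (r / 2) e).
have eps_bd : 0 < eps <= eps0.
  by rewrite !lt_min ge_min lexx/= eps00 e0 divr_gt0.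
have [epsr epse] : eps <= r / 2 /\ eps <= e by rewrite !ge_min !lexx !orbT.
have [delta delta0 hd] := nearest_consistent Th0 hom cl eps_bd.
exists (Num.min delta (r / 2)); first by rewrite lt_min delta0 divr_gt0.
move=> T; rewrite le_min => /andP[/hd[[a ha] sub] Tr].
have r2 : r / 2 < r by rewrite ltr_pdivrMr// ltr_pMr// ltr1n.
have near theta : nearest Theta f T theta -> `|theta0 - theta| < r.
  move=> /sub[_ /(le_trans (normr_le_enorm _))]; rewrite distrC => h.
  by apply: le_lt_trans h _; apply: le_lt_trans r2.
split; last by move=> theta /sub[_ h]; exact: le_trans epse.
exists a; split => // b hb; apply/eqP; apply: contrapT => /negP ab.
have Qab : enorm (f a - T) ^+ 2 = enorm (f b - T) ^+ 2.
  by apply/eqP; rewrite eq_le (ha.2 _ hb.1) (hb.2 _ ha.1).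
have [m Am] := improve T a b (le_lt_trans Tr r2) (near _ ha) (near _ hb) ab Qab.
by rewrite ltNge (ha.2 _ (interior_subset Am)).
Qed.

Theorem theorem4p1 (R : realType)
    (dO : measure_display) (O : measurableType dO) (P : probability O R)
    (d p q : nat) (hp : (1 <= p)%N) (hpq : (p <= q)%N)
    (X : nat -> {RV P >-> d.-tuple R}) (F : 'rV[R]_d -> R)
    (hindep : mutually_independent X)
    (hdf : forall i x, joint_df (X i) x = F x)
    (hF : continuous F)
    (Theta : set 'rV[R]_p) (l : 'rV[R]_p -> d.-tuple R -> R)
    (hl : forall theta, Theta theta -> is_stdf (l theta))
    (theta0 : 'rV[R]_p) (htheta0 : Theta theta0)
    (hl0 : has_stdf (X 0%N) (l theta0))
    (g : d.-tuple R -> 'rV[R]_q)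
    (hg : forall i : 'I_q, (lebesgue_tuple d).-integrable (unit_cube d)
                             (fun x => (g x ord0 i)%:E))
    (k : nat -> nat)
    (hk : forall n, (1 <= n)%N -> (1 <= k n <= n)%N)
    (hk_oo : k n @[n --> \oo] --> \oo)
    (hkn : (k n)%:R / n%:R @[n --> \oo] --> (0 : R))
    (hphi : homeomorphism_on Theta (phi g l))
    (eps0 : R) (heps0 : 0 < eps0)
    (hclosed : closed [set theta | Theta theta /\ enorm (theta - theta0) <= eps0]) :
  (forall eps : R, 0 < eps <= eps0 ->
     P [set w | minimizers X g Theta l n (k n) w !=set0 /\
                minimizers X g Theta l n (k n) w `<=`
                  [set theta | Theta theta /\ enorm (theta - theta0) <= eps]]
     @[n --> \oo] --> 1%E)
  /\
  (Theta° theta0 -> C2_on Theta° (phi g l) ->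
   \rank ('J (phi g l) theta0) = p ->
     P [set w | exists! theta, minimizers X g Theta l n (k n) w theta]
       @[n --> \oo] --> 1%E
     /\
     forall theta_hat : nat -> O -> 'rV[R]_p,
       (forall n j, measurable_fun setT (fun w => theta_hat n w ord0 j)) ->
       (forall n w, (exists! theta, minimizers X g Theta l n (k n) w theta) ->
          minimizers X g Theta l n (k n) w (theta_hat n w)) ->
       cvg_in_probability P theta_hat theta0).
Proof.
have dfE i : joint_df (X i) = F by apply/funext => x; exact: hdf.
have dfX i : joint_df (X i) = joint_df (X 0%N) by rewrite !dfE.
have cX : continuous (joint_df (X 0%N)) by rewrite dfE.
have close := weighted_integral_consistent hindep dfX cX hl0 hg hk hk_oo hkn.
pose T n w := weighted_integral g (stdf_hat X n (k n) w).
have minE n w : minimizers X g Theta l n (k n) w = nearest Theta (phi g l) (T n w).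
  by [].
split=> [eps eps_bd|int C2f rk].
  have [delta delta0 hd] := nearest_consistent htheta0 hphi hclosed eps_bd.
  apply: whp_cvg1; apply: whp_sub (close _ delta0) _ _ => [n|].
    (* Every property of the estimated function is an event, including a statement about the whole
       set of minimizers. *)
    exact: (measurable_stdf_hat_event X n (k n) (fun f =>
      nearest Theta (phi g l) (weighted_integral g f) !=set0 /\
      nearest Theta (phi g l) (weighted_integral g f) `<=`
        [set theta | Theta theta /\ enorm (theta - theta0) <= eps])).
  by apply: nearW => n w /hd.
have uniq e (e0 : 0 < e) := nearest_unique hphi hclosed heps0 int C2f rk e0.
split.
  have [delta delta0 hd] := uniq 1 ltr01.
  apply: whp_cvg1; apply: whp_sub (close _ delta0) _ _ => [n|].
    exact: (measurable_stdf_hat_event X n (k n) (fun f =>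
      exists! theta, nearest Theta (phi g l) (weighted_integral g f) theta)).
  by apply: nearW => n w /hd[].
move=> theta_hat mth hth e e0.
have [delta delta0 hd] := uniq e e0.
apply: (whp_cvg0 (close _ delta0)) => [n|].
  rewrite (_ : mkset _ = [set w | e ^+ 2 < enorm (theta_hat n w - theta0) ^+ 2]).
    rewrite -[Y in measurable Y]setTI; apply: measurable_fun_ltr => //.
    under eq_fun do rewrite enorm_sqr.
    apply: measurable_sum => j; apply: measurable_funX.
    under eq_fun do rewrite !mxE.
    exact: measurable_funB.
  by apply/seteqP; split => w /=; rewrite ltr_sqr ?nnegrE ?enorm_ge0// ltW.
(* Where the integrals are close, the minimizer is unique, so [theta_hat] equals it and is within
   [e] of [theta0]; a larger error can only occur off that event. *)
apply: nearW => n w /= lt_e /hd[ex sub].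
by have := sub _ (hth n w ex); rewrite /= leNgt lt_e.
Qed.
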